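(* Let $k$ be a field of arbitrary characteristic, let $P=k[X_1,X_2,X_3,Y_1,\dots,Y_s]$ be a standard-graded polynomial ring over $k$ in $3+s$ variables for some nonnegative integer $s$, let $B'$ be an ideal of $P$ which is generated by five linearly independent quadratic forms in the variables $X_1,X_2,X_3$, let $B''$ be the ideal $(Y_1,\dots,Y_s)$ of $P$, let $B$ be the ideal $B'+B''$ of $P$, and let $A\subseteq ([P]_1)^5$ be a homogeneous ideal of $P$ with $P/A$ an Artinian Gorenstein local ring. Assume $[\operatorname{socle}(P/B)]_1=0$. Let $R$ be the ring $R=P/(A:_PB)$. Then the second syzygy of the canonical module of $R$, viewed as an $R$-module, has a direct summand isomorphic to $B'/BB'$.
   Context: $[M]_i$ denotes the degree-$i$ homogeneous component of a graded module $M$, and $([P]_1)^5$ denotes the fifth power of the maximal homogeneous ideal of $P$ (the ideal generated by $[P]_1$). The socle of a $P$-module $M$ is $\operatorname{socle}(M)=0:_M\mathfrak M$, where $\mathfrak M$ is the maximal homogeneous ideal of $P$. For ideals $L,M$ of $P$, $(L:_PM)=\{x\in P\mid xM\subseteq L\}$. A second syzygy module of an $R$-module $M$ is an $R$-module $M'$ for which there is an exact sequence $0\to M'\to P_2\to P_1\to M\to 0$ with $P_1,P_2$ projective $R$-modules. By Schanuel's Lemma it is well defined only up to direct sum with a projective module; ''the second syzygy of $M$ has a direct summand isomorphic to $T$'' is understood in this sense, i.e. some second syzygy module of $M$ (with $P_1,P_2$ finitely generated) has a direct summand isomorphic to $T$. The canonical module of $R$ is $\omega_R=\operatorname{Hom}_{P/A}(R,P/A)\cong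 B/A$ (when $A\subseteq B$, which holds here). The $P$-module $B'/BB'$ is annihilated by $(A:_PB)$ and is therefore an $R$-module. *)

(* Defs.v *)
From HB Require Import structures.
From mathcomp Require Import all_boot all_order all_algebra.
From mathcomp Require Import generic_quotient ring_quotient boolp.
From mathcomp.multinomials Require Import mpoly.

Set Implicit Arguments.
Unset Strict Implicit.
Unset Printing Implicit Defensive.

Import GRing.Theory.
Local Open Scope ring_scope.
Local Open Scope quotient_scope.

(* The library's [submodClosed] has no instance of [zmodClosed], which the
   quotient construction needs; hence this record over [submod_closed].
   Membership is boolean, so that the library's subtypes and quotients apply;
   predicates in Prop are turned into booleans by classical logic. *)
Record submod (R : comPzRingType) (V : lmodType R) := Submod {
  submod_mem :> {pred V};
  submod_memP : submod_closed submod_mem }.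

HB.instance Definition _ (R : comPzRingType) (V : lmodType R)
  (N : submod V) :=
  GRing.isSubmodClosed.Build R V (submod_mem N) (submod_memP N).

Notation ideal R := (submod R^o).

Section Submodules.
Context {R : comPzRingType} {V : lmodType R}.

Definition span_mem (G : V -> Prop) : {pred V} := fun x =>
  `[< exists n (c : 'I_n -> R) (g : 'I_n -> V),
        (forall i, G (g i)) /\ x = \sum_i c i *: g i >].

Lemma span_closed (G : V -> Prop) : submod_closed (span_mem G).
Proof.
split=> [|a u v /asboolP[n [c [g [Gg ->]]]] /asboolP[m [d [h [Gh ->]]]]].
  apply/asboolP; exists 0%N, (fun=> 0), (fun=> 0).
  by split=> [[]|]; rewrite ?big_ord0.
apply/asboolP; exists (n + m)%N,
  (fun i => match split i with inl j => a * c j | inr j => d j end),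
  (fun i => match split i with inl j => g j | inr j => h j end).
split=> [i|]; first by case: (split i).
rewrite big_split_ord scaler_sumr /=; congr (_ + _); apply: eq_bigr => i _.
  by rewrite (unsplitK (inl i)) scalerA.
by rewrite (unsplitK (inr i)).
Qed.

Definition span (G : V -> Prop) : submod V := Submod (span_closed G).

Definition add_mem (N N' : submod V) : {pred V} := fun x =>
  `[< exists u v, [/\ u \in N, v \in N' & x = u + v] >].

Lemma add_closed (N N' : submod V) : submod_closed (add_mem N N').
Proof.
split=> [|a _ _ /asboolP[u [v [Nu Nv ->]]] /asboolP[w [z [Nw Nz ->]]]].
  by apply/asboolP; exists 0, 0; rewrite !rpred0 addr0.
apply/asboolP; exists (a *: u + w), (a *: v + z).
by split; rewrite ?rpredD ?rpredZ // scalerDr addrACA.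
Qed.

Definition addsm (N N' : submod V) : submod V := Submod (add_closed N N').

Definition ann_mem (I : ideal R) : {pred V} := fun v =>
  `[< forall a, a \in I -> a *: v = 0 >].

Lemma ann_closed (I : ideal R) : submod_closed (ann_mem I).
Proof.
split=> [|a u v /asboolP hu /asboolP hv]; apply/asboolP=> b Ib.
  by rewrite scaler0.
by rewrite scalerDr scalerA mulrC -scalerA hu // scaler0 add0r hv.
Qed.

End Submodules.

(* 0 :_M I *)
Definition ann {R : comPzRingType} (I : ideal R) (M : lmodType R) : submod M :=
  Submod (@ann_closed R M I).

Section IdealOperations.
Context {R : comPzRingType}.

Lemma ideal0 (I : ideal R) : (0 : R) \in I.
Proof. by have [] := submod_memP I. Qed.

Lemma idealD (I : ideal R) (x y : R) : x \in I -> y \in I -> x + y \in I.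
Proof.
have [_ h] := submod_memP I => Ix Iy; have := h 1 x y Ix Iy.
by rewrite scale1r.
Qed.

Lemma idealM (I : ideal R) (a x : R) : x \in I -> a * x \in I.
Proof.
by have [I0 h] := submod_memP I => Ix; have := h a x 0 Ix I0; rewrite addr0.
Qed.

Definition unit_ideal : ideal R := span (fun x : R^o => x = 1).

Definition mul_ideal (I J : ideal R) : ideal R :=
  span (fun x : R^o => exists a b : R, [/\ a \in I, b \in J & x = a * b]).

Definition exp_ideal (I : ideal R) (n : nat) : ideal R :=
  iter n (mul_ideal I) unit_ideal.

Definition colon_mem (I J : ideal R) : {pred R^o} := fun x =>
  `[< forall y : R, y \in J -> (x : R) * y \in I >].

Lemma colon_closed (I J : ideal R) : submod_closed (colon_mem I J).
Proof.
split=> [|a u v /asboolP hu /asboolP hv]; apply/asboolP=> y Jy.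
  by rewrite mul0r ideal0.
by rewrite mulrDl -mulrA idealD ?hv //; apply/idealM/hu.
Qed.

(* (I :_R J) *)
Definition colon (I J : ideal R) : ideal R := Submod (colon_closed I J).

Lemma sub_colon (I J : ideal R) : {subset I <= colon I J}.
Proof.
by move=> x Ix; apply/asboolP=> y _; rewrite mulrC; apply: idealM.
Qed.

End IdealOperations.

Section SubAndQuotient.
Context {R : comPzRingType} {V : lmodType R}.

Definition sub (N : submod V) : Type := {x : V | x \in N}.
HB.instance Definition _ (N : submod V) := SubChoice.on (sub N).
HB.instance Definition _ (N : submod V) :=
  [SubChoice_isSubLmodule of sub N by <:].

Definition quo (N : submod V) : Type := Quotient.quot N.
HB.instance Definition _ (N : submod V) := EqQuotient.on (quo N).
HB.instance Definition _ (N : submod V) := Choice.on (quo N).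
HB.instance Definition _ (N : submod V) := ZmodQuotient.on (quo N).

Section QuoModule.
Variable N : submod V.

Definition quo_scale (a : R) (x : quo N) : quo N := \pi_(quo N) (a *: repr x).

Lemma eq_quo (x y : V) : (\pi_(quo N) x == \pi_(quo N) y) = (x - y \in N).
Proof. by rewrite -(Quotient.idealrBE N). Qed.

Lemma pi_scale a (x : V) : quo_scale a (\pi x) = \pi_(quo N) (a *: x).
Proof.
apply/eqP; rewrite eq_quo -scalerBr rpredZ // -eq_quo.
by rewrite reprK.
Qed.

Lemma quo_scaleA a b x : quo_scale a (quo_scale b x) = quo_scale (a * b) x.
Proof. by rewrite -[x]reprK (pi_scale b) !pi_scale scalerA. Qed.
Lemma quo_scale1 : left_id 1 quo_scale.
Proof. by move=> x; rewrite -[x]reprK pi_scale scale1r. Qed.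
Lemma quo_scaleDr : right_distributive quo_scale +%R.
Proof.
move=> a x y; rewrite -[x]reprK -[y]reprK.
by rewrite -raddfD !pi_scale scalerDr raddfD.
Qed.
Lemma quo_scaleDl x : {morph quo_scale^~ x : a b / a + b}.
Proof. by move=> a b; rewrite -[x]reprK !pi_scale scalerDl raddfD. Qed.

HB.instance Definition _ := GRing.Zmodule_isLmodule.Build R (quo N)
  quo_scaleA quo_scale1 quo_scaleDr quo_scaleDl.

End QuoModule.
End SubAndQuotient.

Section SubQuotient.
Context {R : comPzRingType} {V : lmodType R}.

Definition preim_mem (N N' : submod V) : {pred sub N} := fun x => val x \in N'.

Lemma preim_closed (N N' : submod V) : submod_closed (@preim_mem N N').
Proof.
split=> [|a u v hu hv]; rewrite /in_mem /= /preim_mem ?raddf0 ?rpred0 //.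
by rewrite linearP rpredD ?rpredZ.
Qed.

(* N / N' for N' contained in N (N / (N :&: N') in general) *)
Definition subquo (N N' : submod V) : lmodType R :=
  quo (Submod (@preim_closed N N')).

End SubQuotient.

Section QuotientRing.
Context {R : comPzRingType}.

(* Unlike [{ideal_quot I}], this does not require I to be proper. *)
Definition qring (I : ideal R) : Type := quo I.
HB.instance Definition _ (I : ideal R) := EqQuotient.on (qring I).
HB.instance Definition _ (I : ideal R) := ZmodQuotient.on (qring I).

Section Ring.
Variable I : ideal R.

Definition qring_one : qring I := \pi_(qring I) (1 : R).
Definition qring_mul (x y : qring I) : qring I :=
  \pi_(qring I) ((repr x : R) * repr y).

Lemma eq_qring (x y : R) : (\pi_(qring I) x == \pi_(qring I) y) = (x - y \in I).
Proof. exact: (@eq_quo R R^o I). Qed.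

Lemma pi_mul (x y : R) : qring_mul (\pi x) (\pi y) = \pi_(qring I) (x * y).
Proof.
have h (z : R) : repr (\pi_(qring I) z) - z \in I by rewrite -eq_qring reprK.
have mulB (a b c d : R) : a * b - c * d = a * (b - d) + d * (a - c).
  by rewrite !mulrBr (mulrC d a) (mulrC d c) addrA subrK.
apply/eqP; rewrite eq_qring mulB.
by apply: idealD; apply: idealM; apply: h.
Qed.

Lemma qring_mulA : associative qring_mul.
Proof.
move=> x y z; rewrite -[x]reprK -[y]reprK -[z]reprK.
by rewrite (pi_mul (repr y)) (pi_mul (repr x) (repr y)) !pi_mul mulrA.
Qed.
Lemma qring_mulC : commutative qring_mul.
Proof.
by move=> x y; rewrite -[x]reprK -[y]reprK pi_mul mulrC; symmetry; apply: pi_mul.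
Qed.
Lemma qring_mul1 : left_id qring_one qring_mul.
Proof. by move=> x; rewrite -[x]reprK [LHS]pi_mul mul1r. Qed.
Lemma qring_mulDl : left_distributive qring_mul +%R.
Proof.
move=> x y z; rewrite -[x]reprK -[y]reprK -[z]reprK.
rewrite -raddfD (pi_mul (repr x)) (pi_mul (repr y)) -raddfD [LHS]pi_mul.
by rewrite mulrDl.
Qed.

HB.instance Definition _ := GRing.Zmodule_isComPzRing.Build (qring I)
  qring_mulA qring_mulC qring_mul1 qring_mulDl.

Lemma qring_piM (x y : R) :
  \pi_(qring I) x * \pi_(qring I) y = \pi_(qring I) (x * y).
Proof. exact: pi_mul. Qed.

End Ring.

Section FactorMap.
Variables (I J : ideal R) (sIJ : {subset I <= J}).

Definition factor_map of {subset I <= J} : qring I -> qring J :=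
  fun x => \pi_(qring J) (repr x).

Lemma factor_mapE (x : R) : factor_map sIJ (\pi x) = \pi_(qring J) x.
Proof. by apply/eqP; rewrite eq_qring sIJ // -eq_qring reprK. Qed.

Lemma factor_map_zmod : zmod_morphism (factor_map sIJ).
Proof.
move=> x y; rewrite -[x]reprK -[y]reprK -raddfB !factor_mapE.
exact: raddfB.
Qed.

Lemma factor_map_monoid : monoid_morphism (factor_map sIJ).
Proof.
split=> [|x y]; first exact: factor_mapE.
rewrite -[x]reprK -[y]reprK qring_piM !factor_mapE.
by rewrite qring_piM.
Qed.

HB.instance Definition _ :=
  GRing.isZmodMorphism.Build (qring I) (qring J) (factor_map sIJ)
    factor_map_zmod.
HB.instance Definition _ :=
  GRing.isMonoidMorphism.Build (qring I) (qring J) (factor_map sIJ)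
    factor_map_monoid.

End FactorMap.

Definition annihilates (I : ideal R) (M : lmodType R) : Prop :=
  forall a (v : M), a \in I -> a *: v = 0.

Section OverQuotient.
Variables (I : ideal R) (M : lmodType R) (IM : annihilates I M).

Definition over_qring of annihilates I M : Type := M.
HB.instance Definition _ := GRing.Zmodule.on (over_qring IM).

Definition over_scale (x : qring I) (v : over_qring IM) : over_qring IM :=
  (repr x : R) *: (v : M).

Lemma over_scaleE (a : R) v : over_scale (\pi a) v = a *: (v : M).
Proof.
apply/eqP; rewrite -subr_eq0 -scalerBl IM //.
by rewrite -eq_qring reprK.
Qed.

Lemma over_scaleA x y v : over_scale x (over_scale y v) = over_scale (x * y) v.
Proof.
rewrite -[x]reprK -[y]reprK qring_piM (over_scaleE (repr y)) !over_scaleE.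
exact: scalerA.
Qed.
Lemma over_scale1 : left_id 1 over_scale.
Proof. by move=> v; rewrite over_scaleE scale1r. Qed.
Lemma over_scaleDr : right_distributive over_scale +%R.
Proof. by move=> x u v; rewrite -[x]reprK !over_scaleE scalerDr. Qed.
Lemma over_scaleDl v : {morph over_scale^~ v : x y / x + y}.
Proof.
move=> x y; rewrite -[x]reprK -[y]reprK -raddfD !over_scaleE.
exact: scalerDl.
Qed.

HB.instance Definition _ :=
  GRing.Zmodule_isLmodule.Build (qring I) (over_qring IM)
    over_scaleA over_scale1 over_scaleDr over_scaleDl.

End OverQuotient.
End QuotientRing.

(* Hom_S(R, S) for a ring morphism phi : S -> R, with R acting on the source:
   (r f)(x) = f(r x). *)
Section HomModule.
Context {S R : comPzRingType} (phi : {rmorphism S -> R}).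

Record homR := HomR {
  homR_fun :> R -> S;
  homR_prop : `[< (forall x y, homR_fun (x + y) = homR_fun x + homR_fun y) /\
                  (forall a x, homR_fun (phi a * x) = a * homR_fun x) >] }.

HB.instance Definition _ := [isSub for homR_fun].
HB.instance Definition _ := gen_eqMixin homR.
HB.instance Definition _ := gen_choiceMixin homR.

Lemma homR_ext (f g : homR) : f =1 g -> f = g.
Proof. by move=> fg; apply: val_inj; apply: funext. Qed.

Lemma homRD (f : homR) x y : f (x + y) = f x + f y.
Proof. by have /asboolP[] := homR_prop f. Qed.

Lemma homRZ (f : homR) a x : f (phi a * x) = a * f x.
Proof. by have /asboolP[] := homR_prop f. Qed.

Program Definition hom_zero := @HomR (fun=> 0) _.
Next Obligation. by apply/asboolP; split=> *; rewrite ?addr0 ?mulr0. Qed.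

Program Definition hom_opp (f : homR) := @HomR (fun x => - f x) _.
Next Obligation.
by apply/asboolP; split=> *; rewrite ?homRD ?homRZ ?opprD ?mulrN.
Qed.

Program Definition hom_add (f g : homR) := @HomR (fun x => f x + g x) _.
Next Obligation.
by apply/asboolP; split=> *; rewrite ?homRD ?homRZ ?mulrDr // addrACA.
Qed.

Program Definition hom_scale (r : R) (f : homR) := @HomR (fun x => f (r * x)) _.
Next Obligation.
apply/asboolP; split=> [x y|a x]; first by rewrite mulrDr homRD.
by rewrite mulrCA homRZ.
Qed.

Lemma hom_addA : associative hom_add.
Proof. by move=> f g h; apply: homR_ext => x /=; rewrite addrA. Qed.
Lemma hom_addC : commutative hom_add.
Proof. by move=> f g; apply: homR_ext => x /=; rewrite addrC. Qed.
Lemma hom_add0 : left_id hom_zero hom_add.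
Proof. by move=> f; apply: homR_ext => x /=; rewrite add0r. Qed.
Lemma hom_addN : left_inverse hom_zero hom_opp hom_add.
Proof. by move=> f; apply: homR_ext => x /=; rewrite addNr. Qed.

HB.instance Definition _ :=
  GRing.isZmodule.Build homR hom_addA hom_addC hom_add0 hom_addN.

Lemma hom_scaleA r s f : hom_scale r (hom_scale s f) = hom_scale (r * s) f.
Proof. by apply: homR_ext => x /=; rewrite mulrA (mulrC s r). Qed.
Lemma hom_scale1 : left_id 1 hom_scale.
Proof. by move=> f; apply: homR_ext => x /=; rewrite mul1r. Qed.
Lemma hom_scaleDr : right_distributive hom_scale +%R.
Proof. by move=> r f g; apply: homR_ext. Qed.
Lemma hom_scaleDl f : {morph hom_scale^~ f : r s / r + s}.
Proof. by move=> r s; apply: homR_ext => x /=; rewrite mulrDl homRD. Qed.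

HB.instance Definition _ := GRing.Zmodule_isLmodule.Build R homR
  hom_scaleA hom_scale1 hom_scaleDr hom_scaleDl.

End HomModule.

Section HomologicalNotions.
Context {R : comPzRingType}.
Implicit Types M N E : lmodType R.

Definition surj {T U : Type} (f : T -> U) : Prop := forall y, exists x, f x = y.

Definition exact {M N E : lmodType R} (f : M -> N) (g : N -> E) : Prop :=
  forall y, g y = 0 <-> exists x, f x = y.

Definition projective (L : lmodType R) : Prop :=
  forall (M N : lmodType R) (g : {linear M -> N}) (f : {linear L -> N}),
    surj g -> exists h : {linear L -> M}, forall x, g (h x) = f x.

Definition injective_mod (E : lmodType R) : Prop :=
  forall (M N : lmodType R) (i : {linear M -> N}) (f : {linear M -> E}),
    injective i -> exists h : {linear N -> E}, forall x, h (i x) = f x.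

Definition fin_gen (M : lmodType R) : Prop :=
  exists n (x : 'I_n -> M), forall v, exists c : 'I_n -> R,
    v = \sum_i c i *: x i.

(* M has an injective resolution 0 -> M -> E_0 -> ... -> E_n -> 0 *)
Fixpoint injdim_le (n : nat) (M : lmodType R) : Prop :=
  if n is n'.+1 then
    exists (E C : lmodType R) (f : {linear M -> E}) (g : {linear E -> C}),
      [/\ injective_mod E, injective f, exact f g, surj g & injdim_le n' C]
  else injective_mod M.

(* 0 -> M' -> P2 -> P1 -> M -> 0 exact, P1 and P2 f.g. projective *)
Definition second_syzygy (M M' : lmodType R) : Prop :=
  exists (P1 P2 : lmodType R) (i : {linear M' -> P2}) (d : {linear P2 -> P1})
         (e : {linear P1 -> M}),
    [/\ projective P1 /\ fin_gen P1, projective P2 /\ fin_gen P2,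
        injective i, exact i d & exact d e /\ surj e].

Definition has_summand (M' T : lmodType R) : Prop :=
  exists (U : lmodType R) (f : {linear (T * U)%type -> M'}), bijective f.

Definition second_syzygy_has_summand (M T : lmodType R) : Prop :=
  exists2 M' : lmodType R, second_syzygy M M' & has_summand M' T.

End HomologicalNotions.

Section RingNotions.
Variable R : comPzRingType.

Definition maximal_ideal (m : ideal R) : Prop :=
  1 \notin m /\
  forall J : ideal R, {subset m <= J} -> 1 \notin J -> {subset J <= m}.

Definition local_ring : Prop :=
  exists2 m : ideal R, maximal_ideal m &
    forall m' : ideal R, maximal_ideal m' -> m' =i m.

Definition artinian : Prop :=
  forall I : nat -> ideal R, (forall n, {subset I n.+1 <= I n}) ->
    exists n, forall p, (n <= p)%N -> {subset I n <= I p}.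

(* Artinian rings being Noetherian, the local ring R is Gorenstein when it has
   finite injective dimension as a module over itself. *)
Definition artinian_gorenstein_local : Prop :=
  [/\ artinian, local_ring & exists n, injdim_le n (R^o : lmodType R)].

End RingNotions.

Section GradedNotions.
Context {k : fieldType} {n : nat}.
Local Notation P := {mpoly k[n]}.

Definition max_homog_ideal : ideal P := span (fun f : P^o => (f : P) \is 1.-homog).

Definition homog_ideal (A : ideal P) : Prop :=
  forall (f : P) d, f \in A -> pihomog mdeg d f \in A.

Definition socle (M : lmodType P) : submod M := ann max_homog_ideal M.

(* x lies in the degree d component of the graded P-module P / A *)
Definition quo_homog (A : ideal P) (d : nat) (x : quo A) : Prop :=
  exists2 f : P, f \is d.-homog & x = \pi f.

End GradedNotions.

(* The variables of {mpoly k[3 + s]} are X_1, X_2, X_3 (indices lshift s j)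
   followed by Y_1, ..., Y_s (indices rshift 3 j); forms in the X's are forms
   of {mpoly k[3]} substituted in. *)
Section Ideals.
Context {k : fieldType} (s : nat) (q : 5.-tuple (dhomog 3 k 2)).
Local Notation P := {mpoly k[3 + s]}.

Definition inX (f : {mpoly k[3]}) : P :=
  f \mPo [tuple 'X_(lshift s j) | j < 3].

Definition idealB' : ideal P :=
  span (fun f : P^o => exists i : 'I_5, f = inX (tnth q i)).

Definition idealB'' : ideal P :=
  span (fun f : P^o => exists j : 'I_s, f = 'X_(rshift 3 j)).

Definition idealB : ideal P := addsm idealB' idealB''.

End Ideals.

(* With R = P / (A :_P B): omega_R = Hom_{P/A}(R, P/A). *)
Definition canonical_module (P : comPzRingType) (A B : ideal P) :
    lmodType (qring (colon A B)) :=
  homR (factor_map (@sub_colon P A B)).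

(* Main.v *)
(* Modulo the Y's, P/B is k[X1,X2,X3]/(five quadrics), and the socle condition
   says that the functional theta on quadrics that vanishes on the five is
   nondegenerate.  It has an orthogonal basis x, y, z of linear forms in every
   characteristic, so the quadrics become yz, xz, xy, ax^2-by^2, ax^2-cz^2.
   Finite injective dimension makes the socle of P/A one-dimensional, whence a
   functional Lam on P under which P/A is self-dual; as A lies in degrees >= 5,
   every functional on quadrics or on cubics has the form Lam(h .).  In
   particular theta = Lam(w .), and (A : B) = A + (w), (A : w) = B.

   Let D be the matrix of the relations on the generators of B/A, with the 5x5
   matrix phi of linear syzygies as its first rows.  A second syzygy v satisfies
   v D = w x modulo A, and v |-> x.g maps the second syzygy module onto B'/BB'
   (g the generators of B').  A matrix H over P with H phi = w Id modulo A gives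
   the splitting r.g |-> (r H, 0); it exists already at the level of functionals
   on cubics, and it is well defined on B'/BB' because the linear syzygies of
   the quadrics are spanned by the rows of phi. *)
Require Import Defs.
From HB Require Import structures.
From mathcomp Require Import all_boot all_order all_algebra.
From mathcomp Require Import ring.
From mathcomp Require Import generic_quotient ring_quotient boolp.
From mathcomp.multinomials Require Import mpoly.
Import GRing.Theory.
Local Open Scope ring_scope.

Set Implicit Arguments.
Unset Strict Implicit.
Unset Printing Implicit Defensive.
Local Open Scope quotient_scope.

(** The ideal A is arbitrary, so w and H cannot be written down as polynomials. Their functionals
    Lam(w .) and Lam(H_jl .) can: they factor through a ring map [sigma] to k[x,y,z] that kills the
    Y's and passes to the orthogonal coordinates, and they read only coefficients of degree two and
    three, which no element of A has. Since Lam is nondegenerate modulo A, each required membership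
    in A is tested by pairing with Lam and becomes an identity between finitely many coefficients of
    ternary polynomials. Neither w nor H need be homogeneous; [order_ge] carries all the degree
    information.

    Two degree counts drive the argument. Modulo the Y's, the ideal of the quadrics contains every
    form of degree 3 and its square every form of degree 4. The first, applied to f with f yz of
    order 5, gives the inclusion of (A : B) in B; this is the origin of the exponent 5. The second
    describes BB' inside B' as the elements whose image under [sigma] has order 4. *)

Section IdealLemmas.
Context {R : comPzRingType}.
Implicit Types I J : ideal R.

Lemma idealN I (x : R) : x \in I -> - x \in I.
Proof. by move=> Ix; rewrite -mulN1r; apply: idealM. Qed.

Lemma ideal_sub I (x y : R) : x \in I -> y \in I -> x - y \in I.
Proof. by move=> Ix Iy; apply: idealD => //; apply: idealN. Qed.

Lemma idealMr I (a x : R) : x \in I -> x * a \in I.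
Proof. by rewrite mulrC; apply: idealM. Qed.

Lemma ideal_sum I (T : Type) (r : seq T) (Q : pred T) (F : T -> R) :
  (forall i, Q i -> F i \in I) -> \sum_(i <- r | Q i) F i \in I.
Proof.
move=> IF; elim/big_rec: _ => [|i x Qi Ix]; first exact: ideal0.
by apply: idealD => //; apply: IF.
Qed.

Lemma mem_span (V : lmodType R) (G : V -> Prop) (x : V) :
  G x -> x \in Defs.span G.
Proof.
move=> Gx; apply/asboolP; exists 1%N, (fun=> 1), (fun=> x).
by split=> //; rewrite big_ord1 scale1r.
Qed.

Lemma span_sub (V : lmodType R) (G : V -> Prop) (N : submod V) :
  (forall x, G x -> x \in N) -> {subset Defs.span G <= N}.
Proof.
move=> sGN x /asboolP[n [c [g [Gg ->]]]].
by apply: rpred_sum => i _; apply/rpredZ/sGN.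
Qed.

Lemma eq_pi I (x y : R) : x - y \in I -> \pi_(qring I) x = \pi_(qring I) y.
Proof. by move=> h; apply/eqP; rewrite eq_qring. Qed.

Lemma pi_eq I (x y : R) : \pi_(qring I) x = \pi_(qring I) y -> x - y \in I.
Proof. by move/eqP; rewrite eq_qring. Qed.

Lemma pi_eq0 I (x : R) : (\pi_(qring I) x == 0) = (x \in I).
Proof.
have -> : 0 = \pi_(qring I) (0 : R) by rewrite raddf0.
by rewrite eq_qring subr0.
Qed.

Lemma pi_sum I (T : Type) (r : seq T) (Q : pred T) (F : T -> R) :
  \pi_(qring I) (\sum_(i <- r | Q i) F i) =
  \sum_(i <- r | Q i) \pi_(qring I) (F i).
Proof. exact: raddf_sum. Qed.

Lemma piD I (x y : R) : \pi_(qring I) (x + y) = \pi_(qring I) x + \pi_(qring I) y.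
Proof. exact: raddfD. Qed.

Lemma piB I (x y : R) : \pi_(qring I) (x - y) = \pi_(qring I) x - \pi_(qring I) y.
Proof. exact: raddfB. Qed.

Lemma quo_eq0 (V : lmodType R) (N : submod V) (v : V) :
  (\pi_(quo N) v == 0) = (v \in N).
Proof.
have -> : 0 = \pi_(quo N) (0 : V) by rewrite raddf0.
by rewrite eq_quo subr0.
Qed.

Lemma quo_surj (V : lmodType R) (N : submod V) (x : quo N) :
  exists v, x = \pi_(quo N) v.
Proof. by exists (repr x); rewrite reprK. Qed.

Lemma quoZ (V : lmodType R) (N : submod V) (a : R) (v : V) :
  a *: \pi_(quo N) v = \pi_(quo N) (a *: v).
Proof. exact: pi_scale. Qed.

Lemma colonP I J (x : R) :
  reflect (forall y, y \in J -> x * y \in I) (x \in colon I J).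
Proof. exact: asboolP. Qed.

Lemma mem_mul_ideal I J (a b : R) : a \in I -> b \in J -> a * b \in mul_ideal I J.
Proof. by move=> Ia Jb; apply: mem_span; exists a, b. Qed.

Lemma quo_lift (I : ideal R) (V : lmodType R) (v : V) :
  (forall a : R, a \in I -> a *: v = 0) ->
  exists f : {linear quo I -> V}, forall a : R, f (\pi_(quo I) a) = a *: v.
Proof.
move=> Iv; pose f (x : quo I) := (repr x : R) *: v.
have fE a : f (\pi_(quo I) a) = a *: v.
  apply/eqP; rewrite -subr_eq0 -scalerBl Iv //.
  by rewrite -(@eq_quo R R^o I) reprK.
have flin : linear f.
  move=> a x y; rewrite -[x]reprK -[y]reprK.
  have -> : a *: \pi_(quo I) (repr x) + \pi_(quo I) (repr y) =
            \pi_(quo I) (a * (repr x : R) + (repr y : R)).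
    by rewrite raddfD; congr (_ + _); apply: (quoZ I).
  by rewrite !fE scalerDl scalerA.
pose hf := GRing.isLinear.Build R (quo I) V _ f flin.
pose F : {linear quo I -> V} := HB.pack f hf.
by exists F.
Qed.

End IdealLemmas.

(* For an Artinian local ring S with maximal ideal [n] and a nonzero socle
   element s0, every module M of finite injective dimension has
   0 :_M n contained in s0 M. *)
Section FiniteInjectiveDimension.
Context {S : comPzRingType}.
Variables (n : ideal S) (s0 : S).
Hypothesis unit_n : forall r : S, r \notin n -> exists r', r' * r - 1 \in n.
Hypothesis s0_neq0 : s0 != 0.
Hypothesis s0_socle : forall r : S, r \in n -> r * s0 = 0.

(** Each new [x] is carried by [n] into the ideal generated so far, so it adds nothing or a copy of
    S/n, until the unit ideal is reached. This is a composition series of S/(ys) in which redundant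
    members are allowed. *)
Fixpoint socle_chain (ys xs : seq S) : Prop :=
  if xs is x :: xs' then
    (forall r : S, r \in n -> r * x \in Defs.span (fun y : S^o => y \in ys)) /\
    socle_chain (x :: ys) xs'
  else (1 : S) \in Defs.span (fun y : S^o => y \in ys).

Definition killed (V : lmodType S) (ys : seq S) (v : V) : Prop :=
  forall y, y \in ys -> y *: v = 0.

Lemma killed_span (V : lmodType S) (ys : seq S) (v : V) (a : S) :
  killed ys v -> a \in Defs.span (fun y : S^o => y \in ys) -> a *: v = 0.
Proof.
move=> kv /asboolP[m [c [g [gys ->]]]]; rewrite scaler_suml big1 // => i _.
by rewrite -scalerA kv ?scaler0 // gys.
Qed.

(** The class of [x] spans a copy of S/n in S/I. The map S/n -> E with 1 |-> e extends to S/I by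
    injectivity, and e' is the image of 1. *)
Lemma injective_extend (E : lmodType S) (I : ideal S) (x : S) (e : E) :
  injective_mod E -> x \notin I -> (forall r : S, r \in n -> r * x \in I) ->
  (forall r : S, r \in n -> r *: e = 0) ->
  exists2 e' : E, x *: e' = e & forall a : S, a \in I -> a *: e' = 0.
Proof.
move=> injE xI nx ne.
have nx0 (a : S) : a \in n -> a *: \pi_(quo I) (x : S^o) = 0.
  by move=> na; apply/eqP; rewrite quoZ quo_eq0; apply: nx.
have [i iE] := quo_lift nx0.
have [f fE] := quo_lift ne.
have i_inj : injective i.
  move=> u v /eqP; rewrite -subr_eq0 -raddfB => /eqP iuv.
  have := iE (repr (u - v)); rewrite reprK iuv quoZ => /esym/eqP.
  rewrite quo_eq0 => Irx; apply/eqP; rewrite -subr_eq0 -[u - v]reprK quo_eq0.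
  (* A representative outside [n] is invertible modulo [n], and then [x] itself would lie in [I]. *)
  apply: contraNT xI => /unit_n[r' r'E].
  have -> : x = r' * (repr (u - v) * x) - (r' * repr (u - v) - 1) * x.
    by rewrite mulrBl mul1r mulrA subKr.
  by apply: ideal_sub; [apply: idealM|apply: nx].
have [h hE] := injE _ _ i f i_inj.
exists (h (\pi_(quo I) (1 : S^o))).
  have -> : e = f (\pi_(quo n) (1 : S^o)) by rewrite fE scale1r.
  rewrite -hE iE scale1r -linearZZ; congr (h _).
  by rewrite quoZ; congr (\pi _); apply: mulr1.
move=> a Ia; rewrite -linearZZ -[RHS](raddf0 h); congr (h _).
by apply/eqP; rewrite quoZ quo_eq0 [_ *: _]mulr1.
Qed.

Definition socle_in (M : lmodType S) : Prop :=
  forall m : M, (forall r : S, r \in n -> r *: m = 0) -> exists m', m = s0 *: m'.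

(* Ext^1(S / (ys), ker g) = 0, by induction along a composition series. *)
Lemma killed_lift (E C : lmodType S) (g : {linear E -> C}) (ys xs : seq S) :
  injective_mod E -> surj g -> socle_in C -> socle_chain ys xs ->
  forall c : C, killed ys c -> exists2 e : E, g e = c & killed ys e.
Proof.
move=> injE sg sC; elim: xs ys => [|x xs IHxs] ys /=.
  move=> h1 c kc; exists 0; last by move=> y _; rewrite scaler0.
  by rewrite raddf0 -(killed_span kc h1) scale1r.
move=> [nx /IHxs IH] c kc.
have [xys|xys] := boolP (x \in Defs.span (fun y : S^o => y \in ys)).
  have [y|e ge ke] := IH c.
    by rewrite inE => /orP[/eqP->|]; [exact: killed_span kc xys|exact: kc].
  by exists e => // y yys; apply: ke; rewrite inE yys orbT.
(* Since [n] kills x c, it equals s0 c'. With e0 over c', the element s0 e0 is killed by [n], hence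
   is x e' with e' killed by [ys]; then c - g e' is killed by [x] as well, and the induction applies
   to it. *)
have [r nr|c' c'E] := sC (x *: c).
  by rewrite scalerA (killed_span kc) // nx.
have [e0 ge0] := sg c'.
have [r nr|e' xe' ke'] := injective_extend (e := s0 *: e0) injE xys nx.
  by rewrite scalerA s0_socle // scale0r.
have ke'ys y : y \in ys -> y *: e' = 0 by move=> yys; apply/ke'/mem_span.
have [y|e3 ge3 ke3] := IH (c - g e').
  rewrite inE scalerBr -linearZZ => /orP[/eqP->|yys].
    by rewrite xe' linearZZ ge0 -c'E subrr.
  by rewrite kc // ke'ys // raddf0 subr0.
exists (e' + e3); first by rewrite raddfD /= ge3 addrC subrK.
by move=> y yys; rewrite scalerDr ke'ys // ke3 ?addr0 // inE yys orbT.
Qed.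

(** For injective modules this is [injective_extend] with I = 0 and x = s0. For 0 -> M -> E -> C ->
    0, write f m = s0 e; then s0 kills g e, which lifts to some e2 killed by s0, and e - e2 comes
    from M. *)
Lemma injdim_socle (xs : seq S) (r : nat) (M : lmodType S) :
  socle_chain [:: s0] xs -> injdim_le r M -> socle_in M.
Proof.
move=> ch.
have injective_case E : injective_mod E -> socle_in E.
  move=> injE m nm.
  have s00 : s0 \notin (Defs.span (fun y : S^o => y = 0) : ideal S).
    apply: contra s0_neq0 => /asboolP[d [c [g [g0 ->]]]].
    by rewrite big1 // => i _; rewrite g0 scaler0.
  have [a na|e' e'E _] := injective_extend injE s00 _ nm.
    by rewrite s0_socle // ideal0.
  by exists e'.
elim: r M => [|r IHr] M /=; first exact: injective_case.
move=> [E [C [f [g [injE inj_f ex_fg sg /IHr sC]]]]] m nm.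
have [a na|e eE] := injective_case E injE (f m).
  by rewrite -linearZZ nm // raddf0.
have [y|e2 ge2 ke2] := killed_lift injE sg sC ch (c := g e).
  rewrite inE => /eqP->; rewrite -linearZZ -eE.
  by apply/ex_fg; exists m.
have [m' fm'] : exists m', f m' = e - e2.
  by apply/ex_fg; rewrite raddfB /= ge2 subrr.
exists m'; apply: inj_f; rewrite linearZZ fm' scalerBr -eE ke2 ?subr0 //.
by rewrite inE.
Qed.

End FiniteInjectiveDimension.

(** * Orders of polynomials *)

Section PolynomialOrder.
Context {k : fieldType} {n : nat}.
Local Notation P := {mpoly k[n]}.
Implicit Types (f g : P) (m : 'X_{1..n}).

(* Membership in the d-th power of the maximal homogeneous ideal. *)
Definition order_ge (d : nat) f : Prop := forall m, (mdeg m < d)%N -> f@_m = 0.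

Lemma order_geM d e f g :
  order_ge d f -> order_ge e g -> order_ge (d + e) (f * g).
Proof.
move=> hf hg m hm; rewrite mcoeffM big1 // => -[m1 m2] /=.
move=> /eqP/(congr1 mdeg); rewrite mdegD => mE.
case: (ltnP (mdeg m1) d) => [/hf->|le1]; first by rewrite mul0r.
rewrite hg ?mulr0 // -(ltn_add2l (mdeg m1)) -mE (leq_trans hm) //.
by rewrite leq_add2r.
Qed.

Lemma order_ge_closed d :
  submod_closed ((fun f : P^o => `[< order_ge d f >]) : {pred P^o}).
Proof.
split=> [|a u v /asboolP hu /asboolP hv]; apply/asboolP=> m hm.
  by rewrite mcoeff0.
by rewrite mcoeffD hv // (@order_geM 0 d) // addr0.
Qed.

Definition order_ideal d : ideal P := Submod (order_ge_closed d).

Lemma order_idealP d f : reflect (order_ge d f) (f \in order_ideal d).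
Proof. exact: asboolP. Qed.

Lemma dhomog_order d f : f \is d.-homog -> order_ge d f.
Proof.
by move=> hf m hm; apply: (dhomog_nemf_coeff hf); rewrite neq_ltn hm.
Qed.

Lemma order_ge1 f : order_ge 1 f <-> f@_0 = 0.
Proof.
split=> [h|h m]; first by apply: h; rewrite mdeg0.
by rewrite ltnS leqn0 mdeg_eq0 => /eqP->.
Qed.

Lemma exp_ideal_order d : {subset exp_ideal (@max_homog_ideal k n) d <= order_ideal d}.
Proof.
have m1 : {subset @max_homog_ideal k n <= order_ideal 1}.
  by apply: span_sub => f hf; apply/order_idealP/dhomog_order.
elim: d => [|d IHd]; first by move=> f _; apply/order_idealP.
apply: span_sub => _ [a [b [/m1/order_idealP ha /IHd/order_idealP hb ->]]].
by apply/order_idealP/(@order_geM 1 d).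
Qed.

Lemma mcoeff_pihomog d f m : (pihomog mdeg d f)@_m = if mdeg m == d then f@_m else 0.
Proof.
rewrite {2}[f]mpolyE pihomogE !raddf_sum /=.
case: eqP => md.
  rewrite big_mkcond; apply: eq_bigr => m' _; rewrite !mcoeffZ !mcoeffX.
  case: eqP => // hm'.
  by case: eqP => [mm|]; [case: hm'; rewrite mm|rewrite mulr0].
rewrite big1 // => m' /eqP hm'; rewrite mcoeffZ mcoeffX.
by case: eqP => [mm|]; [case: md; rewrite -mm|rewrite mulr0].
Qed.

Lemma pihomog_eq0 d e f : order_ge e f -> (d < e)%N -> pihomog mdeg d f = 0.
Proof.
move=> hf hd; apply/mpolyP => m; rewrite mcoeff_pihomog mcoeff0.
by case: eqP => // md; rewrite hf // md.
Qed.

Lemma mpoly_ideal (I : ideal P) f :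
  (forall m, f@_m != 0 -> 'X_[m] \in I) -> f \in I.
Proof.
move=> h; rewrite [f]mpolyE big_seq; apply: ideal_sum => m.
by rewrite mcoeff_msupp => /h Im; rewrite -mul_mpolyC; apply: idealM.
Qed.

Lemma idealZ (I : ideal P) (c : k) f : f \in I -> c *: f \in I.
Proof. by rewrite -mul_mpolyC; apply: idealM. Qed.

Lemma order_geX d m : (d <= mdeg m)%N -> order_ge d ('X_[m] : P).
Proof.
move=> h m' hm'; rewrite mcoeffX; case: eqP => // mm.
by move: hm'; rewrite -mm ltnNge h.
Qed.

End PolynomialOrder.

(** * Ideals and socle chains in a quotient ring *)

Section ImageIdeal.
Context {R : comPzRingType} (A : ideal R).

Definition image_mem (J : ideal R) : {pred (qring A)^o} :=
  fun x => `[< exists2 f : R, f \in J & x = \pi_(qring A) f >].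

Lemma image_closed (J : ideal R) : submod_closed (image_mem J).
Proof.
split=> [|a _ _ /asboolP[f Jf ->] /asboolP[g Jg ->]]; apply/asboolP.
  by exists 0; rewrite ?ideal0 ?raddf0.
exists ((repr a : R) * f + g); first by apply: idealD => //; apply: idealM.
rewrite raddfD; congr (_ + _).
by rewrite -[LHS]/(a * \pi f) -{1}[a]reprK qring_piM.
Qed.

Definition image_ideal (J : ideal R) : ideal (qring A) := Submod (image_closed J).

Lemma image_idealP (J : ideal R) (x : qring A) :
  reflect (exists2 f : R, f \in J & x = \pi_(qring A) f) (x \in image_ideal J).
Proof. exact: asboolP. Qed.

End ImageIdeal.

Section SocleChain.
Context {S : comPzRingType} (n : ideal S).

Lemma socle_chain_sub (ys ys' xs : seq S) :
  {subset Defs.span (fun y : S^o => y \in ys) <= Defs.span (fun y : S^o => y \in ys')} ->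
  socle_chain n ys xs -> socle_chain n ys' xs.
Proof.
elim: xs ys ys' => [|x xs IHxs] ys ys' sub /=; first exact: sub.
case=> nx ch; split=> [r nr|]; first by apply/sub/nx.
apply: IHxs ch; apply: span_sub => y; rewrite inE => /orP[/eqP->|yys].
  by apply: mem_span; rewrite inE eqxx.
have: y \in Defs.span (fun y : S^o => y \in ys') by apply/sub/mem_span.
by apply: span_sub => z zys'; apply: mem_span; rewrite inE zys' orbT.
Qed.

Lemma socle_chain_cat (ys zs xs : seq S) :
  (forall z r : S, z \in zs -> r \in n -> r * z \in Defs.span (fun y : S^o => y \in ys)) ->
  socle_chain n (zs ++ ys) xs -> socle_chain n ys (zs ++ xs).
Proof.
elim: zs ys => [|z zs IHzs] ys nz //= ch; split=> [r nr|].
  by apply: nz => //; rewrite inE eqxx.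
apply: IHzs => [z' r z'zs nr|].
  have: r * z' \in Defs.span (fun y : S^o => y \in ys).
    by apply: nz => //; rewrite inE z'zs orbT.
  by apply: span_sub => y yys; apply: mem_span; rewrite inE yys orbT.
apply: socle_chain_sub ch; apply: span_sub => y yz; apply: mem_span.
by move: yz; rewrite inE !mem_cat inE orbCA.
Qed.

End SocleChain.

(** * Graded Artinian Gorenstein quotients: the one-dimensional socle and the dualizing
    functional *)

Section GradedArtinianGorenstein.
Context {k : fieldType} {n : nat}.
Local Notation P := {mpoly k[n]}.
Implicit Types (f g : P) (m : 'X_{1..n}).
Variable A : ideal P.
Hypothesis homA : homog_ideal A.

(** The images of the order ideals stabilize at some N. A monomial of degree at least N is therefore
    congruent modulo A to a polynomial of larger order, and its own graded component of that
    congruence puts it in A. *)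
Lemma artinian_bound : artinian (qring A) ->
  exists N, forall f, order_ge N f -> f \in A.
Proof.
move=> artA; pose I d := image_ideal A (order_ideal d).
have [d x /image_idealP[f /order_idealP hf ->]|N hN] := artA I.
  apply/image_idealP; exists f => //; apply/order_idealP => m hm.
  by apply: hf; rewrite ltnS ltnW.
exists N => f hf; apply: mpoly_ideal => m fm.
have Nm : (N <= mdeg m)%N.
  by rewrite leqNgt; apply: contra fm => /hf->.
have : \pi_(qring A) ('X_[m] : P) \in I N.
  by apply/image_idealP; exists 'X_[m] => //; apply/order_idealP/order_geX.
move/(hN (mdeg m).+1 (leqW Nm)) => /image_idealP[g /order_idealP hg].
move/pi_eq => /(homA (mdeg m)); rewrite pihomogB (pihomog_eq0 hg) // subr0.
by rewrite pihomog_dE // dhomogX.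
Qed.

Hypothesis A1 : (1 : P) \notin A.
Hypothesis artA : artinian (qring A).

(** The socle degree: e + 1 is the least order that forces membership in A. *)
Lemma top_degree : exists e,
  (exists2 f, f \is e.-homog & f \notin A) /\
  (forall f, order_ge e.+1 f -> f \in A).
Proof.
have [N hN] := artinian_bound artA.
have ex : exists N, `[< forall f, order_ge N f -> f \in A >].
  by exists N; apply/asboolP.
case: (ex_minnP ex) => -[|e] /asboolP hE minE.
  by case/negP: A1; apply: hE.
exists e; split=> //; apply: contrapT => no.
have : `[< forall f, order_ge e f -> f \in A >].
  apply/asboolP => f hf.
  have -> : f = pihomog mdeg e f + (f - pihomog mdeg e f) by rewrite addrC subrK.
  apply: idealD.
    apply: contrapT => /negP fA; apply: no; exists (pihomog mdeg e f) => //.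
    exact: pihomogP.
  apply: hE => m; rewrite ltnS leq_eqVlt mcoeffB mcoeff_pihomog => /orP[->|hm].
    exact: subrr.
  by rewrite hf // if_same subr0.
by move/minE; rewrite ltnn.
Qed.

(** Downward through the degrees: once [ys] generates all monomials of degree above N, the finitely
    many of degree N are carried by the maximal ideal into (ys) and can be adjoined. Degree 0
    contributes 1. *)
Lemma nilpotent_socle_chain N (ys : seq (qring A)) :
  (forall m, (N <= mdeg m)%N ->
    \pi_(qring A) 'X_[m] \in Defs.span (fun y : (qring A)^o => y \in ys)) ->
  exists xs, socle_chain (image_ideal A (order_ideal 1)) ys xs.
Proof.
elim: N ys => [|N IHN] ys hys.
  by exists [::]; have := hys 0%MM (leq0n _); rewrite mpolyX0.
pose zs : seq (qring A) :=
  [seq \pi_(qring A) ('X_[m] : P)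
    | m : 'X_{1..n < N.+1} <- enum {: 'X_{1..n < N.+1}} & mdeg m == N].
have [m|xs ch] := IHN (zs ++ ys).
  rewrite leq_eqVlt => /orP[/eqP Nm|/hys]; last first.
    by apply: span_sub => y yys; apply: mem_span; rewrite mem_cat yys orbT.
  have mN : (mdeg m < N.+1)%N by rewrite -Nm.
  apply: mem_span; rewrite mem_cat; apply/orP; left; apply/mapP.
  by exists (BMultinom mN) => //; rewrite mem_filter /= -Nm eqxx mem_enum.
exists (zs ++ xs); apply: socle_chain_cat ch => z r /mapP[m].
rewrite mem_filter => /andP[/eqP mN _] -> /image_idealP[f /order_idealP hf ->].
rewrite qring_piM [f]mpolyE mulr_suml pi_sum big_seq.
apply: ideal_sum => m'; rewrite mcoeff_msupp => fm'.
rewrite -mul_mpolyC -mulrA -mpolyXD. rewrite -qring_piM; apply: idealM; apply: hys.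
rewrite mdegD mN -add1n leq_add2r; case: (posnP (mdeg m')) => // m'0.
by move: fm'; rewrite hf ?eqxx // m'0.
Qed.

Hypothesis finA : exists r, injdim_le r ((qring A)^o : lmodType (qring A)).

(** [injdim_socle] for P/A over itself says that the socle lies in s0 (P/A), and s0 g depends only
    on the constant term of g. *)
Lemma socle_line (s0 f : P) : s0 \notin A ->
  (forall g, order_ge 1 g -> g * s0 \in A) ->
  (forall g, order_ge 1 g -> g * f \in A) ->
  exists c, f - c *: s0 \in A.
Proof.
move=> s0A ms0 mf; pose nA := image_ideal A (order_ideal 1).
have unit_nA (r : qring A) : r \notin nA -> exists r', r' * r - 1 \in nA.
  rewrite -[r]reprK; move: (repr r) => g gn.
  have g0 : g@_0 != 0.
    apply: contra gn => /eqP g0; apply/image_idealP; exists g => //.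
    exact/order_idealP/order_ge1.
  exists (\pi_(qring A) ((g@_0)^-1)%:MP); apply/image_idealP.
  exists (((g@_0)^-1)%:MP * g - 1); last by rewrite piB -qring_piM.
  apply/order_idealP/order_ge1; rewrite mcoeffB mul_mpolyC mcoeffZ mcoeff1 eqxx.
  by rewrite mulVf ?subrr.
have [N hN] := artinian_bound artA.
have [m hm|xs ch] := @nilpotent_socle_chain N [:: \pi_(qring A) s0].
  suff -> : \pi_(qring A) ('X_[m] : P) = 0 by apply: ideal0.
  by apply/eqP; rewrite pi_eq0; apply/hN/order_geX.
have [r injA] := finA.
have pis0 : \pi_(qring A) s0 != 0 by rewrite pi_eq0.
have s0_soc (x : qring A) : x \in nA -> x * \pi_(qring A) s0 = 0.
  move=> /image_idealP[g /order_idealP hg ->]; rewrite qring_piM.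
  by apply/eqP; rewrite pi_eq0 ms0.
have [x|x fx] := injdim_socle unit_nA pis0 s0_soc ch injA (m := \pi_(qring A) f).
  move=> /image_idealP[g /order_idealP hg ->]; rewrite -[LHS]/(_ * _) qring_piM.
  by apply/eqP; rewrite pi_eq0 mf.
move: fx; rewrite -[x]reprK -[RHS]/(_ * _) qring_piM => /pi_eq; set g := (repr x : P) => fg.
exists g@_0.
have -> : f - g@_0 *: s0 = f - s0 * g + (g - (g@_0)%:MP) * s0.
  by rewrite mulrBl mul_mpolyC addrA (mulrC g) subrK.
apply: idealD => //; apply: ms0; apply/order_ge1.
by rewrite mcoeffB mcoeffC eqxx mulr1 subrr.
Qed.

(** [Lam] reads the coefficient of the socle generator [s0] in the top-degree component modulo A.
    For f outside A take g of the largest order with f g outside A: the maximal ideal carries f g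
    into A, so f g is congruent to a nonzero multiple of [s0]. *)
Lemma gorenstein_functional : exists Lam : {scalar P},
  [/\ forall f, f \in A -> Lam f = 0
    & forall f, (forall g, Lam (f * g) = 0) -> f \in A].
Proof.
have [e [[s0 hs0 s0A] hE]] := top_degree.
have ms0 g : order_ge 1 g -> g * s0 \in A.
  by move=> hg; apply/hE/(@order_geM _ _ 1 e) => //; apply: dhomog_order.
have exL f : exists c, pihomog mdeg e f - c *: s0 \in A.
  apply: socle_line => // g hg; apply/hE/(@order_geM _ _ 1 e) => //.
  exact/dhomog_order/pihomogP.
have /(@choice _ _ (fun f c => pihomog mdeg e f - c *: s0 \in A))[Lam LamE] := exL.
have s0_uniq c : c *: s0 \in A -> c = 0.
  move=> cA; apply/eqP; apply: contraNT s0A => c0.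
  have -> : s0 = (c^-1)%:MP * (c *: s0) by rewrite mul_mpolyC scalerA mulVf ?scale1r.
  exact: idealM.
have LamP f c : pihomog mdeg e f - c *: s0 \in A -> Lam f = c.
  move=> h; apply/eqP; rewrite -subr_eq0; apply/eqP/s0_uniq.
  have := ideal_sub h (LamE f); rewrite opprB addrC addrA subrK -scalerBl.
  by [].
have LamA f : f \in A -> Lam f = 0.
  by move=> /(homA e) h; apply: LamP; rewrite scale0r subr0.
have linLam : scalar Lam.
  move=> c f g; apply: LamP.
  rewrite linearP scalerDl -scalerA opprD addrACA -scalerBr.
  by apply: idealD; [apply/idealZ/LamE|apply: LamE].
pose LamH := GRing.isLinear.Build k P k _ Lam linLam.
pose LamL : {scalar P} := HB.pack Lam LamH.
exists LamL; split=> // f hf.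
apply: contrapT => /negP fA.
pose Q d := `[< exists2 g, order_ge d g & f * g \notin A >].
have [N hN] := artinian_bound artA.
have Q0 : exists d, Q d.
  by exists 0%N; apply/asboolP; exists 1; rewrite ?mulr1.
have QN d : Q d -> (d <= N)%N.
  move=> /asboolP[g hg fgA]; rewrite leqNgt; apply: contra fgA => /ltnW Nd.
  by apply/idealM/hN => m hm; apply: hg; apply: leq_trans hm Nd.
case: (ex_maxnP Q0 QN) => d /asboolP[g hg fgA] maxd.
have [h hh|c cE] := @socle_line s0 (f * g) s0A ms0.
  apply: contrapT => /negP hfg.
  have /maxd : Q d.+1; last by rewrite ltnn.
  apply/asboolP; exists (h * g); first exact: (@order_geM _ _ 1 d).
  by rewrite mulrCA.
have c0 : c != 0.
  apply: contraNneq fgA => c0; move: cE; rewrite c0 scale0r subr0.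
  by [].
have Lams0 : Lam s0 = 1 by apply: LamP; rewrite pihomog_dE // scale1r subrr ideal0.
suff : Lam (f * g) = c by rewrite [LHS]hf => /esym/eqP; rewrite (negPf c0).
apply: LamP.
have -> : pihomog mdeg e (f * g) - c *: s0 = pihomog mdeg e (f * g - c *: s0).
  by rewrite pihomogB [in RHS](pihomog_dE (rpredZ c hs0)).
exact: homA.
Qed.

End GradedArtinianGorenstein.

(** * Self-duality of P/A under a nondegenerate functional *)

Section FunctionalRepresentation.
Context {k : fieldType} {n : nat}.
Local Notation P := {mpoly k[n]}.

Definition mk_scalar (f : P -> k) (lin_f : scalar f) : {scalar P} :=
  HB.pack f (GRing.isLinear.Build k P k _ f lin_f).

Variables (A : ideal P) (N : nat) (Lam : {scalar P}).
Hypothesis A_bound : forall f, order_ge N f -> f \in A.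
Hypothesis LamA : forall f : P, f \in A -> Lam f = 0.
Hypothesis Lam_nondeg : forall f, (forall g, Lam (f * g) = 0) -> f \in A.

Lemma scalar_eq0 (nu : {scalar P}) :
  (forall f : P, f \in A -> nu f = 0) ->
  (forall m : 'X_{1..n < N}, nu 'X_[m] = 0) -> forall g, nu g = 0.
Proof.
move=> nuA nuX g; rewrite [g]mpolyE raddf_sum big1 //= => m _.
rewrite linearZ /=; case: (ltnP (mdeg m) N) => [mN|Nm].
  by rewrite (nuX (BMultinom mN)) mulr0.
by rewrite nuA ?mulr0 //; apply/A_bound/order_geX.
Qed.

(** Linear algebra with the Gram matrix [G] of Lam on monomials of degree below N. These span P/A
    but may be dependent, so [G] can be singular; [mu] is in its row space because a combination
    annihilated by [G] lies in A by nondegeneracy, and [mu] kills A. *)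
Lemma functional_repr (mu : {scalar P}) :
  (forall f : P, f \in A -> mu f = 0) -> exists h, forall g, Lam (h * g) = mu g.
Proof.
move=> muA; pose I := 'X_{1..n < N}.
pose mon (i : 'I_#|{: I}|) : P := 'X_[(enum_val i : I) : 'X_{1..n}].
pose poly (c : 'I_#|{: I}| -> k) := \sum_i c i *: mon i.
have polyE (nu : {scalar P}) c : nu (poly c) = \sum_i c i * nu (mon i).
  by rewrite raddf_sum; apply: eq_bigr => i _; rewrite /= linearZ.
have LamMlin (f : P) : scalar (fun g => Lam (f * g)).
  by move=> c g g'; rewrite mulrDr -scalerAr linearP.
pose LamM f : {scalar P} := mk_scalar (LamMlin f).
have monP (nu : {scalar P}) : (forall f : P, f \in A -> nu f = 0) ->
    (forall i, nu (mon i) = 0) -> forall g, nu g = 0.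
  move=> nuA nuX; apply: scalar_eq0 => // m.
  by have := nuX (enum_rank m); rewrite /mon enum_rankK.
have LamMA f : forall g, g \in A -> LamM f g = 0.
  by move=> g Ag; apply/LamA/idealM.
pose G := \matrix_(i, j) Lam (mon i * mon j).
pose u := \row_i mu (mon i).
have : (u <= G)%MS.
  rewrite submxE; apply/eqP/rowP => j; rewrite mxE [RHS]mxE.
  pose v i := cokermx G i j.
  have vA : poly v \in A.
    apply: Lam_nondeg => g; apply: (monP _ (LamMA (poly v))) => i /=.
    rewrite mulrC -[LHS]/(LamM (mon i) (poly v)) polyE.
    have /matrixP/(_ i j) := mulmx_coker G; rewrite !mxE => sum0.
    rewrite -[RHS]sum0.
    by apply: eq_bigr => l _; rewrite mxE mulrC.
  by rewrite -[RHS](muA _ vA) polyE; apply: eq_bigr => i _; rewrite mxE mulrC.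
case/submxP => c cG; exists (poly (c 0)) => g; apply/eqP; rewrite -subr_eq0.
have sublin : scalar (fun g => Lam (poly (c 0) * g) - mu g).
  move=> a f f'; rewrite mulrDr -scalerAr !linearP /=.
  by rewrite mulrBr opprD addrACA.
pose sb : {scalar P} := mk_scalar sublin.
apply/eqP/(monP sb) => [f Af /=|i /=].
  by rewrite muA // LamA ?subrr //; apply: idealM.
have /rowP/(_ i) := cG; rewrite !mxE => ->.
rewrite mulrC -[X in X - _]/(LamM (mon i) (poly (c 0))) polyE.
apply/eqP; rewrite subr_eq0; apply/eqP/eq_bigr => j _.
by rewrite mxE /= mulrC [mon i * _]mulrC mulrC.
Qed.

End FunctionalRepresentation.

(** * Finite generation of relations modulo A *)

Section FiniteGeneration.

(** A subspace of largest dimension inside [Z] absorbs every vector of [Z]. *)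
Lemma closed_vspace (F : fieldType) (vT : vectType F) (Z : vT -> Prop) :
  Z 0 -> (forall e u v, Z u -> Z v -> Z (e *: u + v)) ->
  exists U : {vspace vT}, forall v, v \in U <-> Z v.
Proof.
move=> Z0 Zlin.
pose Q d := `[< exists2 U : {vspace vT}, \dim U = d & forall v, v \in U -> Z v >].
have Q0 : exists d, Q d.
  exists 0%N; apply/asboolP; exists 0%VS; first by rewrite dimv0.
  by move=> v; rewrite memv0 => /eqP->.
have Qbound d : Q d -> (d <= \dim {:vT})%N.
  by move=> /asboolP[U <- _]; apply/dimvS/subvf.
case: (ex_maxnP Q0 Qbound) => d /asboolP[U dimU UZ] maxd.
exists U => v; split=> [/UZ //|Zv].
have : (\dim (U + <[v]>) <= \dim U)%N.
  rewrite dimU; apply: maxd; apply/asboolP; exists (U + <[v]>)%VS => // u.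
  move=> /memv_addP[u1 /UZ Zu1 [_ /vlineP[e ->] ->]].
  by rewrite addrC; apply: Zlin.
rewrite (geq_leqif (dimv_leqif_sup (addvSl _ _))) => /subvP; apply.
by apply: (subvP (addvSr _ _)); apply: memv_line.
Qed.

(** Modulo A every polynomial equals its truncation below degree N. The truncated relations form a
    finite-dimensional space over k, and a basis of it generates all relations modulo A. *)
Lemma relations_fin_gen (k : fieldType) (n N m : nat) (A : ideal {mpoly k[n]})
    (g : 'I_m -> {mpoly k[n]}) :
  (forall f, order_ge N f -> f \in A) ->
  exists t (G : 'I_t -> 'I_m -> {mpoly k[n]}),
    (forall u, \sum_i G u i * g i \in A) /\
    (forall f : 'I_m -> {mpoly k[n]}, \sum_i f i * g i \in A ->
       exists c : 'I_t -> {mpoly k[n]}, forall i, f i - \sum_u c u * G u i \in A).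
Proof.
move=> A_bound; pose M := 'X_{1..n < N}.
pose mon (j : 'I_#|{: M}|) : {mpoly k[n]} := 'X_[(enum_val j : M) : 'X_{1..n}].
pose F (v : 'M[k]_(m, #|{: M}|)) i := \sum_j v i j *: mon j.
have FP e u v i : F (e *: u + v) i = e *: F u i + F v i.
  rewrite /F scaler_sumr -big_split; apply: eq_bigr => j _.
  by rewrite !mxE scalerDl scalerA.
have [|e u v Zu Zv|U UE] := @closed_vspace k 'M[k]_(m, #|{: M}|)
  (fun v => \sum_i F v i * g i \in A).
- rewrite big1 ?ideal0 // => i _; rewrite /F big1 ?mul0r // => j _.
  by rewrite mxE scale0r.
- have -> : \sum_i F (e *: u + v) i * g i =
            e *: (\sum_i F u i * g i) + \sum_i F v i * g i.
    rewrite scaler_sumr -big_split; apply: eq_bigr => i _.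
    by rewrite FP mulrDl -scalerAl.
  by apply: idealD => //; apply: idealZ.
exists (\dim U), (fun u => F (vbasis U)`_u); split=> [u|f fA].
  by apply/UE/vbasis_mem/mem_nth; rewrite size_tuple.
pose v : 'M[k]_(m, #|{: M}|) := \matrix_(i, j) (f i)@_(enum_val j : M).
have fv i : f i - F v i \in A.
  apply: A_bound => m' m'N; rewrite mcoeffB.
  rewrite /F raddf_sum (bigD1 (enum_rank (BMultinom m'N : M))) //= big1.
    by rewrite addr0 mxE /mon enum_rankK mcoeffZ mcoeffX eqxx mulr1 subrr.
  move=> j jm'; rewrite mcoeffZ mcoeffX; case: eqP => [mE|]; last by rewrite mulr0.
  case/eqP: jm'; apply: enum_val_inj; rewrite enum_rankK; exact: val_inj.
have vU : v \in U.
  apply/UE.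
  have -> : \sum_i F v i * g i = \sum_i f i * g i - \sum_i (f i - F v i) * g i.
    rewrite -sumrB; apply: eq_bigr => i _.
    by rewrite -mulrBl opprB addrC subrK.
  by apply: ideal_sub => //; apply: ideal_sum => i _; apply: idealMr.
exists (fun u => (coord (vbasis U) u v)%:MP) => i.
suff <- : F v i = \sum_u (coord (vbasis U) u v)%:MP * F (vbasis U)`_u i by [].
rewrite {1}(coord_vbasis vU) /F.
under [RHS]eq_bigr => u _ do rewrite mul_mpolyC scaler_sumr.
rewrite exchange_big; apply: eq_bigr => j _ /=.
rewrite summxE scaler_suml; apply: eq_bigr => u _.
by rewrite !mxE scalerA.
Qed.

End FiniteGeneration.

(** * Free modules and retracts *)

Section ModuleConstructions.
Context {R : comPzRingType}.

Lemma projective_row n : projective ('rV[R]_n : lmodType R).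
Proof.
move=> M N g f sg.
have [m mE] := choice (fun i : 'I_n => sg (f (delta_mx 0 i))).
pose h (v : 'rV[R]_n) := \sum_i v 0 i *: m i.
have lin : linear h.
  move=> e u v; rewrite /h scaler_sumr -big_split; apply: eq_bigr => i _.
  by rewrite !mxE scalerDl scalerA.
pose H : {linear 'rV[R]_n -> M} :=
  HB.pack h (GRing.isLinear.Build R 'rV[R]_n M _ h lin).
exists H => v; rewrite /= /h raddf_sum [v in RHS]row_sum_delta raddf_sum.
by apply: eq_bigr => i _; rewrite /= !linearZZ mE.
Qed.

Lemma fin_gen_row n : fin_gen ('rV[R]_n : lmodType R).
Proof.
exists n, (fun i => delta_mx 0 i) => v; exists (fun i => v 0 i).
exact: row_sum_delta.
Qed.

Lemma retract_summand (M T : lmodType R) (f : {linear T -> M}) (r : {linear M -> T}) :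
  (forall t, r (f t) = t) -> has_summand M T.
Proof.
move=> rf.
have kerc : submod_closed ((fun v : M => r v == 0) : {pred M}).
  split=> [|e u v]; first by rewrite /in_mem /= raddf0.
  by rewrite /in_mem /= linearP => /eqP-> /eqP->; rewrite scaler0 addr0.
pose U := sub (Submod kerc).
pose h (tu : (T * U)%type) : M := f tu.1 + val tu.2.
have lin : linear h.
  move=> e [t u] [t' u']; rewrite /h /= !linearP /=.
  by rewrite scalerDr !addrA; congr (_ + _); rewrite addrAC.
pose H : {linear (T * U)%type -> M} :=
  HB.pack h (GRing.isLinear.Build R (T * U)%type M _ h lin).
have kerr (v : M) : v - f (r v) \in Submod kerc.
  by rewrite /in_mem /= raddfB /= rf subrr.
exists U, H; exists (fun v => (r v, Sub (v - f (r v)) (kerr v) : U)).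
  move=> [t u]; have /eqP ru := valP u.
  have rh : r (H (t, u)) = t by rewrite /= /h raddfD /= rf ru addr0.
  apply/pair_equal_spec; split; first exact: rh.
  by apply: val_inj; rewrite SubK rh /= /h addrC addKr.
by move=> v; rewrite /= /h /= addrC subrK.
Qed.

End ModuleConstructions.

(** * Splitting B'/BB' off the second syzygy of the canonical module *)

Section SyzygySplitting.
Context {P : comPzRingType}.
Variables (A B' B : ideal P) (d s t : nat).
Variables (g : 'I_d -> P) (Y : 'I_s -> P) (w : P).
Variables (phi H : 'I_d -> 'I_d -> P) (G : 'I_t -> 'I_(d + s) -> P).
Local Notation Q := (colon A B).
Local Notation R := (qring Q).
Local Notation BB' := (mul_ideal B B').

Hypothesis B'P : forall f : P, f \in B' <-> exists r : 'I_d -> P, f = \sum_i r i * g i.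
Hypothesis BP : forall f : P, f \in B <->
  exists (f' : P) (u : 'I_s -> P), f' \in B' /\ f = f' + \sum_j u j * Y j.
Hypothesis colon_sub_B : forall f : P, f \in Q -> f \in B.
Hypothesis A_sub_mul : forall (r : 'I_d -> P) (u : 'I_s -> P),
  \sum_i r i * g i + \sum_j u j * Y j \in A -> \sum_i r i * g i \in BB'.
Hypothesis w_mul_colon : forall e : P, e * w \in Q.
Hypothesis w_nondeg : forall f : P, w * f \in A -> f \in B.
Hypothesis colon_w : forall f : P, f \in Q -> exists x : P, f - x * w \in A.
Hypothesis colonK : forall f : P, (forall e : P, e \in Q -> f * e \in A) -> f \in B.
Hypothesis phi_syzygy : forall l, \sum_i phi l i * g i = 0.
Hypothesis H_phi : forall j i, \sum_l H j l * phi l i - (if j == i then w else 0) \in A.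
Hypothesis H_colon : forall (r : 'I_d -> P) l,
  \sum_j r j * g j \in BB' -> \sum_j r j * H j l \in Q.

Definition gens (i : 'I_(d + s)) : P :=
  match split i with inl i => g i | inr j => Y j end.

Hypothesis G_rel : forall u, \sum_i G u i * gens i \in A.
Hypothesis G_gen : forall f : 'I_(d + s) -> P, \sum_i f i * gens i \in A ->
  exists c : 'I_t -> P, forall i, f i - \sum_u c u * G u i \in A.

(** The rows of [G] generate the relations modulo A; the rows of [phi], padded by 0 in the Y
    columns, are put in front to give the splitting coordinates to land in. *)
Definition rels (l : 'I_(d + t)) (i : 'I_(d + s)) : P :=
  match split l with
  | inl l => match split i with inl i => phi l i | inr _ => 0 end
  | inr u => G u i
  end.

Lemma split_lshift m n (i : 'I_m) : split (lshift n i) = inl i.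
Proof. exact: (unsplitK (inl i)). Qed.

Lemma split_rshift m n (i : 'I_n) : split (rshift m i) = inr i.
Proof. exact: (unsplitK (inr i)). Qed.

Lemma gens_sum (f : 'I_(d + s) -> P) : \sum_i f i * gens i =
  \sum_i f (lshift s i) * g i + \sum_j f (rshift d j) * Y j.
Proof.
rewrite big_split_ord; congr (_ + _); apply: eq_bigr => i _.
  by rewrite /gens split_lshift.
by rewrite /gens split_rshift.
Qed.

Lemma gensP (f : P) : f \in B <-> exists c : 'I_(d + s) -> P, f = \sum_i c i * gens i.
Proof.
split=> [/BP[f' [u [/B'P[r ->] ->]]]|[c ->]].
  exists (fun i => match split i with inl i => r i | inr j => u j end).
  rewrite gens_sum; congr (_ + _); apply: eq_bigr => i _.
    by rewrite split_lshift.
  by rewrite split_rshift.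
rewrite gens_sum; apply/BP; exists (\sum_i c (lshift s i) * g i), (fun j => c (rshift d j)).
by split=> //; apply/B'P; exists (fun i => c (lshift s i)).
Qed.

Lemma gens_mem i : gens i \in B.
Proof.
apply/gensP; exists (fun j => (j == i)%:R).
by rewrite (bigD1 i) //= eqxx mul1r big1 ?addr0 // => j /negPf->; rewrite mul0r.
Qed.

Lemma rels_gens l : \sum_i rels l i * gens i \in A.
Proof.
rewrite /rels; case: (split l) => [l'|u]; last exact: G_rel.
rewrite gens_sum [X in _ + X]big1 => [|j _]; last by rewrite split_rshift mul0r.
under eq_bigr => i _ do rewrite split_lshift.
by rewrite phi_syzygy addr0 ideal0.
Qed.

(** Adding a combination of relation rows to x thus leaves the class of x.g in B'/BB' unchanged. *)
Lemma rels_mul l : \sum_i rels l (lshift s i) * g i \in BB'.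
Proof.
apply: (A_sub_mul (u := fun j => rels l (rshift d j))).
by rewrite -(gens_sum (rels l)); apply: rels_gens.
Qed.

Lemma colon_annihilates : annihilates Q (subquo B' BB').
Proof.
move=> e x Qe; have [v ->] := quo_surj x; rewrite (@quoZ P).
apply/eqP; rewrite quo_eq0 /in_mem /= /preim_mem linearZZ.
apply: mem_mul_ideal; last exact: valP.
exact: colon_sub_B.
Qed.

Local Notation T := (over_qring colon_annihilates).

Definition pi_row m (f : 'I_m -> P) : 'rV[R]_m := \row_i \pi_R (f i).

Lemma pi_row_repr m (v : 'rV[R]_m) : exists f, v = pi_row f.
Proof.
exists (fun i => repr (v 0 i)); apply/rowP => i.
by rewrite mxE reprK.
Qed.

Lemma pi_row_eq m (f f' : 'I_m -> P) :
  pi_row f = pi_row f' <-> forall i, f i - f' i \in Q.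
Proof.
split=> [/rowP h i|h]; first by have := h i; rewrite !mxE => /pi_eq.
by apply/rowP => i; rewrite !mxE; apply: eq_pi.
Qed.

Lemma pi_rowP m (e : P) (f f' : 'I_m -> P) :
  \pi_R e *: pi_row f + pi_row f' = pi_row (fun i => e * f i + f' i).
Proof. by apply/rowP => i; rewrite !mxE piD -qring_piM. Qed.

Lemma pi_row0 m : pi_row (fun _ : 'I_m => 0) = 0.
Proof. by apply/rowP => i; rewrite !mxE; apply/eqP; rewrite pi_eq0 ideal0. Qed.

Lemma canonical_elt (f : P) : f \in B ->
  exists h : canonical_module A B, forall e : P, h (\pi_R e) = \pi_(qring A) (e * f).
Proof.
move=> Bf; pose h (x : R) : qring A := \pi_(qring A) ((repr x : P) * f).
have hE e : h (\pi_R e) = \pi_(qring A) (e * f).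
  have /colonP eQ : (repr (\pi_R e) : P) - e \in Q.
    by apply/(@pi_eq P); rewrite reprK.
  by apply: eq_pi; rewrite -mulrBl; apply: eQ.
have hP : `[< (forall x y : R, h (x + y) = h x + h y) /\
    (forall (e : qring A) (x : R), h (factor_map (@sub_colon P A B) e * x) = e * h x) >].
  apply/asboolP; split=> [x y|e x].
    by rewrite -[x]reprK -[y]reprK -piD !hE mulrDl piD.
  by rewrite -[e]reprK -[x]reprK factor_mapE qring_piM !hE qring_piM mulrA.
by exists (HomR hP).
Qed.

(** A homomorphism is determined by its value f at 1. As (A : B) f lies in A, the double annihilator
    property [colonK] puts f in B. With [canonical_elt] this identifies the canonical module with
    B/A. *)
Lemma canonical_eltP (h : canonical_module A B) :
  exists2 f : P, f \in B & forall e : P, h (\pi_R e) = \pi_(qring A) (e * f).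
Proof.
pose f : P := repr (h (\pi_R 1)).
have hf (e : P) : h (\pi_R e) = \pi_(qring A) (e * f).
  have -> : \pi_R e = factor_map (@sub_colon P A B) (\pi_(qring A) e) * \pi_R 1.
    by rewrite factor_mapE qring_piM mulr1.
  by rewrite homRZ -[h _]reprK qring_piM.
exists f => //; apply: colonK => e Qe; rewrite mulrC.
apply/eqP; rewrite -pi_eq0 -hf; apply/eqP.
have -> : \pi_R e = 0 by apply/eqP; rewrite pi_eq0.
have /(congr1 (fun v => v - h 0)) := homRD h 0 0.
by rewrite addr0 subrr addrK => <-; apply: eqxx.
Qed.


Lemma canonical_surjection :
  exists eps : {linear 'rV[R]_(d + s) -> canonical_module A B},
    surj eps /\ forall f, eps (pi_row f) = 0 <-> \sum_i f i * gens i \in A.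
Proof.
(* The choice is made for all f, with the default 0 outside B; only values at elements of B are
   read. *)
have hex f : exists h : canonical_module A B, f \in B ->
    forall e : P, h (\pi_R e) = \pi_(qring A) (e * f).
  have [/canonical_elt[h hE]|_] := boolP (f \in B); first by exists h.
  by exists 0.
have [hb hbE] := choice hex.
pose eps (v : 'rV[R]_(d + s)) := hb (\sum_i (repr (v 0 i) : P) * gens i).
have epsE f e : eps (pi_row f) (\pi_R e) = \pi_(qring A) (e * \sum_i f i * gens i).
  rewrite /eps hbE; last by apply/gensP; eexists.
  apply: eq_pi; rewrite -mulrBr; apply: idealM; rewrite -sumrB.
  apply: ideal_sum => i _; rewrite -mulrBl mxE.
  have /colonP fQ : (repr (\pi_R (f i)) : P) - f i \in Q.
    by apply/(@pi_eq P); rewrite reprK.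
  exact/fQ/gens_mem.
have lin : linear eps.
  move=> x u v; have [f ->] := pi_row_repr u; have [f' ->] := pi_row_repr v.
  rewrite -[x]reprK pi_rowP; apply: homR_ext => x'; rewrite -[x']reprK.
  rewrite epsE -[RHS]/(eps (pi_row f) (\pi_R _ * \pi_R _) + eps (pi_row f') (\pi_R _)).
  rewrite qring_piM !epsE -piD; congr (\pi _).
  rewrite !mulr_sumr -big_split; apply: eq_bigr => i _ /=; ring.
pose epsL : {linear 'rV[R]_(d + s) -> canonical_module A B} :=
  HB.pack eps (GRing.isLinear.Build R 'rV[R]_(d + s) (canonical_module A B) _ eps lin).
exists epsL; split=> [h|f].
  have [f0 /gensP[f ->] hE] := canonical_eltP h.
  exists (pi_row f); apply: homR_ext => x; rewrite -[x]reprK hE.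
  exact: epsE.
split=> [f0|fA].
  have := epsE f 1; rewrite [eps _]f0 mul1r => /esym h.
  by rewrite -pi_eq0 h.
apply: homR_ext => x; rewrite -[x]reprK [LHS]epsE; apply/eqP.
by rewrite pi_eq0; apply: idealM.
Qed.

Definition relsM : 'M[R]_(d + t, d + s) := \matrix_(l, i) \pi_R (rels l i).

Lemma relsME (f : 'I_(d + t) -> P) :
  pi_row f *m relsM = pi_row (fun i => \sum_l f l * rels l i).
Proof.
apply/rowP => i; rewrite !mxE pi_sum; apply: eq_bigr => l _.
by rewrite !mxE qring_piM.
Qed.

(** Matrix entries live modulo (A : B) and relations modulo A. The two agree because the generators
    lie in B, so (A : B) times a generator lies in A. *)
Lemma relsM_exact (f : 'I_(d + s) -> P) :
  \sum_i f i * gens i \in A <-> exists z, z *m relsM = pi_row f.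
Proof.
split=> [/G_gen[c cE]|[z]].
  exists (pi_row (fun l => match split l with inl _ => 0 | inr u => c u end)).
  rewrite relsME; apply/pi_row_eq => i; rewrite big_split_ord /= big1 => [|l _].
    rewrite add0r.
    under eq_bigr => u _ do rewrite /rels !split_rshift.
    have /(@idealN P) := @sub_colon P A B _ (cE i).
    by rewrite opprB.
  by rewrite split_lshift mul0r.
have [f' ->] := pi_row_repr z; rewrite relsME => /pi_row_eq h.
have -> : \sum_i f i * gens i = \sum_i (\sum_l f' l * rels l i) * gens i
    - \sum_i (\sum_l f' l * rels l i - f i) * gens i.
  by rewrite -sumrB; apply: eq_bigr => i _; ring.
apply: ideal_sub; last first.
  by apply: ideal_sum => i _; have /colonP hi := h i; apply/hi/gens_mem.
under eq_bigr => i _ do rewrite mulr_suml.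
rewrite exchange_big; apply: ideal_sum => l _ /=.
under eq_bigr => i _ do rewrite -mulrA.
by rewrite -mulr_sumr; apply/idealM/rels_gens.
Qed.

Lemma ker_relsM_closed :
  submod_closed ((fun z : 'rV[R]_(d + t) => z *m relsM == 0) : {pred 'rV[R]_(d + t)}).
Proof.
split=> [|e u v]; first by rewrite /in_mem /= mul0mx.
by rewrite /in_mem /= mulmxDl -scalemxAl => /eqP-> /eqP->; rewrite scaler0 addr0.
Qed.

Definition syzygy2 := Submod ker_relsM_closed.

Lemma syzygy2P : second_syzygy (canonical_module A B) (sub syzygy2).
Proof.
have [eps [eps_surj epsE]] := canonical_surjection.
exists 'rV[R]_(d + s), 'rV[R]_(d + t), (val : {linear sub syzygy2 -> 'rV[R]_(d + t)}),
  (mulmxr relsM), eps; split.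
- by split; [apply: projective_row|apply: fin_gen_row].
- by split; [apply: projective_row|apply: fin_gen_row].
- exact: val_inj.
- move=> z; split=> [/eqP hz|[v <-]]; last by apply/eqP/(valP v).
  by exists (Sub z hz : sub syzygy2).
split=> // y; have [f ->] := pi_row_repr y.
by rewrite epsE; apply: relsM_exact.
Qed.

Definition comb (r : 'I_d -> P) : P := \sum_i r i * g i.

Lemma comb_mem r : comb r \in B'.
Proof. by apply/B'P; exists r. Qed.

Lemma combP e r r' : comb (fun i => e * r i + r' i) = e * comb r + comb r'.
Proof.
rewrite /comb mulr_sumr -big_split; apply: eq_bigr => i _ /=.
by rewrite mulrDl mulrA.
Qed.

Definition cls (r : 'I_d -> P) : T :=
  \pi_(subquo B' BB') (Sub (comb r) (comb_mem r) : sub B').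

Lemma cls_eq r r' : cls r = cls r' <-> comb (fun i => r i - r' i) \in BB'.
Proof.
have -> : comb (fun i => r i - r' i) = comb r - comb r'.
  by rewrite -sumrB; apply: eq_bigr => i _; rewrite mulrBl.
by split=> [/eqP|h]; [|apply/eqP]; rewrite (@eq_quo P).
Qed.

Lemma cls_surj (x : T) : exists r, x = cls r.
Proof.
have [v ->] := @quo_surj P _ _ (x : subquo B' BB').
have /B'P[r rE] := valP v; exists r; congr (\pi _); exact: val_inj.
Qed.

Lemma clsP (e : P) r r' :
  \pi_R e *: cls r + cls r' = cls (fun i => e * r i + r' i).
Proof.
rewrite -[_ *: _]/(over_scale _ _) over_scaleE (@quoZ P).
rewrite -[LHS]/(\pi_(subquo B' BB') _ + \pi_(subquo B' BB') _) -raddfD.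
congr (\pi _); apply: val_inj; rewrite [RHS]combP.
by [].
Qed.

(* The graph of the retraction z |-> x.g of the second syzygy module onto
   B'/BB'; x itself depends on the choice of the lift f. *)
Definition connected (z : 'rV[R]_(d + t)) (x : 'I_d -> P) : Prop :=
  exists2 f, z = pi_row f &
    forall i, \sum_l f l * rels l (lshift s i) - x i * w \in A.

Lemma connectedP (e : P) z z' x x' : connected z x -> connected z' x' ->
  connected (\pi_R e *: z + z') (fun i => e * x i + x' i).
Proof.
move=> [f -> fE] [f' -> f'E]; exists (fun l => e * f l + f' l) => [|i].
  exact: pi_rowP.
have -> : \sum_l (e * f l + f' l) * rels l (lshift s i) - (e * x i + x' i) * w =
    e * (\sum_l f l * rels l (lshift s i) - x i * w) +
    (\sum_l f' l * rels l (lshift s i) - x' i * w).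
  rewrite mulrBr mulr_sumr addrACA -big_split /= mulrDl opprD mulrA; congr (_ + _).
  by apply: eq_bigr => l _; rewrite mulrDl mulrA.
by apply: idealD => //; apply: idealM.
Qed.

(** If z = 0, every f_l lies in (A : B), so f_l is xi_l w modulo A. Cancelling w leaves x_i
    congruent to the sum of xi_l rels_li modulo B. Pairing with g, the error goes into BB' and the
    relation rows do so by [rels_mul]. *)
Lemma connected0 x : connected 0 x -> comb x \in BB'.
Proof.
move=> [f /esym f0 fE].
have fQ l : f l \in Q.
  have : pi_row f = pi_row (fun=> 0) by rewrite f0 pi_row0.
  by move/pi_row_eq/(_ l); rewrite subr0.
have [xi xiE] := choice (fun l => colon_w (fQ l)).
have xB i : x i - \sum_l xi l * rels l (lshift s i) \in B.
  apply: w_nondeg.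
  have -> : w * (x i - \sum_l xi l * rels l (lshift s i)) =
      \sum_l (f l - xi l * w) * rels l (lshift s i)
      - (\sum_l f l * rels l (lshift s i) - x i * w).
    rewrite opprB addrCA -sumrB mulrBr mulr_sumr [w * _]mulrC; congr (_ + _).
    by rewrite -sumrN; apply: eq_bigr => l _; ring.
  by apply: ideal_sub => //; apply: ideal_sum => l _; apply/idealMr/xiE.
have -> : comb x = \sum_i (x i - \sum_l xi l * rels l (lshift s i)) * g i
    + \sum_l xi l * \sum_i rels l (lshift s i) * g i.
  under [X in _ + X]eq_bigr => l _ do rewrite mulr_sumr.
  rewrite [X in _ + X]exchange_big -big_split; apply: eq_bigr => i _ /=.
  rewrite mulrBl mulr_suml; under [X in _ + X]eq_bigr => l _ do rewrite mulrA.
  by rewrite subrK.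
apply: idealD; last by apply: ideal_sum => l _; apply/idealM/rels_mul.
apply: ideal_sum => i _; apply: mem_mul_ideal => //; apply/B'P.
exists (fun j => (j == i)%:R).
by rewrite (bigD1 i) //= eqxx mul1r big1 ?addr0 // => j /negPf->; rewrite mul0r.
Qed.

Lemma connected_uniq z x x' : connected z x -> connected z x' -> cls x = cls x'.
Proof.
move=> zx zx'; apply/cls_eq; apply: connected0.
have := connectedP (-1) zx' zx.
have -> : \pi_R (-1) *: z + z = 0.
  have [f ->] := pi_row_repr z; rewrite pi_rowP -[RHS](pi_row0 (d + t)).
  by apply/pi_row_eq => l; rewrite mulN1r addNr subr0 ideal0.
move=> [f fE fx]; exists f => // i; have := fx i.
by rewrite mulN1r [- _ + _]addrC.
Qed.

Lemma connected_ex z : z \in syzygy2 -> exists x, connected z x.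
Proof.
move=> /eqP; have [f ->] := pi_row_repr z; rewrite relsME -(pi_row0 (d + s)).
move/pi_row_eq => h.
have hQ i : \sum_l f l * rels l (lshift s i) \in Q by have := h (lshift s i); rewrite subr0.
have [x xE] := choice (fun i => colon_w (hQ i)).
by exists x, f.
Qed.

Definition lift_fun (r : 'I_d -> P) (l : 'I_(d + t)) : P :=
  match split l with inl l => \sum_j r j * H j l | inr _ => 0 end.

Definition lift_row (r : 'I_d -> P) : 'rV[R]_(d + t) := pi_row (lift_fun r).

Lemma lift_fun_rels r i :
  \sum_l lift_fun r l * rels l (lshift s i) - r i * w \in A.
Proof.
rewrite big_split_ord /= [X in _ + X - _]big1 => [|u _]; last first.
  by rewrite /lift_fun split_rshift mul0r.
rewrite addr0; under eq_bigr => l _ do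
  rewrite /lift_fun split_lshift /rels !split_lshift mulr_suml.
rewrite exchange_big /=.
have -> : \sum_j \sum_l r j * H j l * phi l i - r i * w =
    \sum_j r j * (\sum_l H j l * phi l i - (if j == i then w else 0)).
  have <- : \sum_j r j * (if j == i then w else 0) = r i * w.
    rewrite (bigD1 i) //= eqxx big1 ?addr0 // => j /negPf->; exact: mulr0.
  rewrite -sumrB; apply: eq_bigr => j _; rewrite mulrBr mulr_sumr.
  by congr (_ - _); apply: eq_bigr => l _; rewrite mulrA.
by apply: ideal_sum => j _; apply/idealM/H_phi.
Qed.

Lemma lift_connected r : connected (lift_row r) r.
Proof. by exists (lift_fun r) => // i; apply: lift_fun_rels. Qed.

Lemma lift_rowP (e : P) r r' :
  \pi_R e *: lift_row r + lift_row r' = lift_row (fun i => e * r i + r' i).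
Proof.
rewrite pi_rowP; congr pi_row; apply: funext => l; rewrite /lift_fun.
case: (split l) => [l'|_].
  rewrite mulr_sumr -big_split; apply: eq_bigr => j _ /=.
  by rewrite mulrDl mulrA.
by rewrite mulr0 addr0.
Qed.

Lemma lift_row_eq r r' : cls r = cls r' -> lift_row r = lift_row r'.
Proof.
move=> /cls_eq rr'; apply/pi_row_eq => l; rewrite /lift_fun.
case: (split l) => [l'|_]; last first.
  by rewrite subr0 ideal0.
have := H_colon l' rr'; rewrite -sumrB.
by under eq_bigr => j _ do rewrite mulrBl.
Qed.

Lemma lift_row_syzygy r : lift_row r \in syzygy2.
Proof.
apply/eqP; rewrite relsME -(pi_row0 (d + s)); apply/pi_row_eq => i; rewrite subr0.
case: (split_ordP i) => [i' ->|j ->].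
  rewrite -[X in X \in _](subrK (r i' * w)).
  by apply: (@idealD P); [apply/sub_colon/lift_fun_rels|apply: w_mul_colon].
rewrite big1 ?ideal0 // => l _; rewrite /lift_fun /rels split_rshift.
by case: (split l) => [l'|u]; rewrite ?mulr0 ?mul0r.
Qed.

Theorem second_syzygy_splits :
  exists ann_B'BB' : annihilates Q (subquo B' BB'),
    second_syzygy_has_summand (canonical_module A B) (over_qring ann_B'BB').
Proof.
exists colon_annihilates; exists (sub syzygy2); first exact: syzygy2P.
(* [rep] is an arbitrary choice of coefficients; [f] is linear nevertheless, because [lift_row]
   depends only on the class. *)
have [rep repE] := choice cls_surj.
pose f (x : T) : sub syzygy2 := Sub (lift_row (rep x)) (lift_row_syzygy (rep x)).
have f_lin : linear f.
  move=> e x x'; apply: val_inj; rewrite linearP /= -[e]reprK lift_rowP.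
  by apply: lift_row_eq; rewrite -clsP -!repE.
pose fL : {linear T -> sub syzygy2} :=
  HB.pack f (GRing.isLinear.Build R T (sub syzygy2) _ f f_lin).
have [con conE] := choice (fun z : sub syzygy2 => connected_ex (valP z)).
pose r (z : sub syzygy2) : T := cls (con z).
have r_lin : linear r.
  move=> e z z'; rewrite -[e]reprK clsP; apply: (connected_uniq (conE _)).
  by rewrite linearP; apply: connectedP (conE z) (conE z').
pose rL : {linear sub syzygy2 -> T} :=
  HB.pack r (GRing.isLinear.Build R (sub syzygy2) T _ r r_lin).
apply: (retract_summand (f := fL) (r := rL)) => x.
rewrite [RHS]repE; apply: connected_uniq (conE _) _.
exact: lift_connected.
Qed.

End SyzygySplitting.

(** * Ternary polynomials and the normal form of the five quadrics *)

Definition mnm3 (i j l : nat) : 'X_{1..3} := [multinom tnth [tuple i; j; l] u | u < 3].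

Definition var3 (i : nat) : 'I_3 := inord i.

Module TernaryNotations.
Notation "f .@[ i , j , l ]" := (f@_(mnm3 i j l))
  (at level 2, i, j, l at level 9).
Notation x := ('X_(var3 0) : {mpoly _[3]}).
Notation y := ('X_(var3 1) : {mpoly _[3]}).
Notation z := ('X_(var3 2) : {mpoly _[3]}).
End TernaryNotations.

(* [ring] and [field] compare their atoms by conversion, which is very slow on
   distinct coefficients of polynomials. *)
Ltac gen_mcoeff :=
  repeat match goal with
  | |- context [@mcoeff ?n ?R ?m ?f] => generalize (@mcoeff n R m f)
  end; move=> *.

Section TernaryQuadrics.
Import TernaryNotations.
Context {k : fieldType}.
Local Notation K := {mpoly k[3]}.
Implicit Types (f g : K).

Lemma mnm3E (m : 'X_{1..3}) : m = mnm3 (m (var3 0)) (m (var3 1)) (m (var3 2)).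
Proof.
apply/mnmP => -[[|[|[|//]]] lt_u]; rewrite mnmE (tnth_nth 0%N) /=;
  by congr (m _); apply: val_inj; rewrite /= inordK.
Qed.

Lemma mdeg_mnm3 i j l : mdeg (mnm3 i j l) = (i + j + l)%N.
Proof.
by rewrite mdegE !big_ord_recl big_ord0 !mnmE !(tnth_nth 0%N) /= addn0 addnA.
Qed.

Lemma mcoeffXM n (i : 'I_n) (f : {mpoly k[n]}) m :
  ('X_i * f)@_m = if m i == 0%N then 0 else f@_(m - U_(i)).
Proof.
case: eqP => [mi|/eqP mi].
  rewrite mcoeffM big1 // => -[m1 m2] /= /eqP/mnmP/(_ i).
  rewrite mi mnmDE mcoeffX; case: eqP => [<-|_ _]; last by rewrite mul0r.
  by rewrite mnm1E eqxx.
have {1}-> : m = (U_(i) + (m - U_(i)))%MM.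
  by rewrite addmC submK //; apply/mnm_lepP => j; rewrite mnm1E;
    case: eqP => [<-|//]; rewrite lt0n.
by rewrite mulrC mcoeffMX.
Qed.


Lemma mnm3_subX i j l : (mnm3 i.+1 j l - U_(var3 0))%MM = mnm3 i j l.
Proof.
apply/mnmP => -[[|[|[|//]]] lt_u]; rewrite mnmBE mnm1E !mnmE !(tnth_nth 0%N) /=;
  by rewrite -val_eqE /= inordK //= ?subn0 ?subn1.
Qed.

Lemma mnm3_subY i j l : (mnm3 i j.+1 l - U_(var3 1))%MM = mnm3 i j l.
Proof.
apply/mnmP => -[[|[|[|//]]] lt_u]; rewrite mnmBE mnm1E !mnmE !(tnth_nth 0%N) /=;
  by rewrite -val_eqE /= inordK //= ?subn0 ?subn1.
Qed.

Lemma mnm3_subZ i j l : (mnm3 i j l.+1 - U_(var3 2))%MM = mnm3 i j l.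
Proof.
apply/mnmP => -[[|[|[|//]]] lt_u]; rewrite mnmBE mnm1E !mnmE !(tnth_nth 0%N) /=;
  by rewrite -val_eqE /= inordK //= ?subn0 ?subn1.
Qed.

Lemma mnm3X i j l : mnm3 i j l (var3 0) = i.
Proof. by rewrite mnmE (tnth_nth 0%N) /= inordK. Qed.

Lemma mnm3Y i j l : mnm3 i j l (var3 1) = j.
Proof. by rewrite mnmE (tnth_nth 0%N) /= inordK. Qed.

Lemma mnm3Z i j l : mnm3 i j l (var3 2) = l.
Proof. by rewrite mnmE (tnth_nth 0%N) /= inordK. Qed.

Lemma mcoeff_xS f i j l : (x * f).@[i.+1, j, l] = f.@[i, j, l].
Proof. by rewrite mcoeffXM mnm3X mnm3_subX. Qed.
Lemma mcoeff_x0 f j l : (x * f).@[0, j, l] = 0.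
Proof. by rewrite mcoeffXM mnm3X. Qed.
Lemma mcoeff_yS f i j l : (y * f).@[i, j.+1, l] = f.@[i, j, l].
Proof. by rewrite mcoeffXM mnm3Y mnm3_subY. Qed.
Lemma mcoeff_y0 f i l : (y * f).@[i, 0, l] = 0.
Proof. by rewrite mcoeffXM mnm3Y. Qed.
Lemma mcoeff_zS f i j l : (z * f).@[i, j, l.+1] = f.@[i, j, l].
Proof. by rewrite mcoeffXM mnm3Z mnm3_subZ. Qed.
Lemma mcoeff_z0 f i j : (z * f).@[i, j, 0] = 0.
Proof. by rewrite mcoeffXM mnm3Z. Qed.

(** These rules strip a variable from the left of a product. Monomials to be evaluated are therefore
    nested to the right and end in an explicit factor 1, as in y * (z * 1). *)
Definition mcoeff3E := (mcoeff_xS, mcoeff_x0, mcoeff_yS, mcoeff_y0, mcoeff_zS,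
  mcoeff_z0, mcoeffD, mcoeffN, mcoeffZ, mcoeffCM, mcoeff0).

Variables (a b c : k).
Hypotheses (a0 : a != 0) (b0 : b != 0) (c0 : c != 0).

Definition quad5 (i : 'I_5) : K :=
  nth 0 [:: y * z; x * z; x * y;
    a%:MP * (x * x) - b%:MP * (y * y); a%:MP * (x * x) - c%:MP * (z * z)] i.

(* The alternating matrix of the linear syzygies of [quad5]. *)
Definition form5 (i j : 'I_5) : K := nth 0 (nth [::]
  [:: [:: 0; - (c%:MP * z); b%:MP * y; x; - x];
      [:: c%:MP * z; 0; - (a%:MP * x); 0; y];
      [:: - (b%:MP * y); a%:MP * x; 0; - z; 0];
      [:: - x; 0; z; 0; 0];
      [:: x; - y; 0; 0; 0]] i) j.

Definition theta f : k := f.@[2, 0, 0] / a + f.@[0, 2, 0] / b + f.@[0, 0, 2] / c.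

(* A matrix of functionals on cubics inverse to [form5] up to [theta].  The
   alternating solution needs a division by 2, which this one avoids: the two
   differ by the matrix mu(p_i p_j _), where p = [quad5] and mu is a functional
   on forms of degree 7. *)
Definition cubic5 (i j : 'I_5) f : k := nth 0 (nth [::]
  [:: [:: 0; 0; - f.@[0, 3, 0] / b ^+ 2; 0; f.@[3, 0, 0] / a + f.@[1, 0, 2] / c];
      [:: - f.@[0, 0, 3] / c ^+ 2; 0; f.@[3, 0, 0] / a ^+ 2; 0; - f.@[0, 3, 0] / b];
      [:: 0; 0; 0; f.@[0, 0, 3] / c + f.@[0, 2, 1] / b + f.@[2, 0, 1] / a;
          f.@[2, 0, 1] / a + f.@[0, 0, 3] / c];
      [:: f.@[3, 0, 0] / a + f.@[1, 2, 0] / b; f.@[0, 3, 0] / b + f.@[2, 1, 0] / a;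
          - f.@[0, 0, 3] / c; 0; 0];
      [:: 0; f.@[0, 3, 0] / b + f.@[2, 1, 0] / a + f.@[0, 1, 2] / c; 0;
          f.@[1, 1, 1]; 0]] i) j.

Lemma form5_quad5 i : \sum_j form5 i j * quad5 j = 0.
Proof.
by rewrite !big_ord_recl big_ord0; case: i => [[|[|[|[|[|//]]]]] lt_i];
  rewrite /form5 /quad5 /=; ring.
Qed.

Lemma cubic5_form5 i j f :
  \sum_l cubic5 j l (form5 l i * f) = if j == i then theta f else 0.
Proof.
rewrite !big_ord_recl big_ord0; case: i => [[|[|[|[|[|//]]]]] lt_i];
  case: j => [[|[|[|[|[|//]]]]] lt_l]; rewrite /form5 /cubic5 /theta -val_eqE /=;
  rewrite ?mulNr -?mulrA ?mul0r !mcoeff3E; gen_mcoeff; field; rewrite ?a0 ?b0 ?c0 //.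
Qed.

End TernaryQuadrics.

Section SpanFinite.
Import TernaryNotations.
Context {R : comPzRingType} {V : lmodType R}.

Lemma span_finP (m : nat) (g : 'I_m -> V) (v : V) :
  v \in Defs.span (fun u : V => exists i, u = g i) <->
  exists r : 'I_m -> R, v = \sum_i r i *: g i.
Proof.
split=> [/asboolP[d [c [h [hG ->]]]]|[r ->]]; last first.
  by apply: rpred_sum => i _; apply/rpredZ/mem_span; exists i.
have [e eE] := choice hG.
exists (fun i => \sum_(u < d | e u == i) c u).
rewrite (partition_big e xpredT) //=; apply: eq_bigr => i _.
by rewrite scaler_suml; apply: eq_bigr => u /eqP<-; rewrite eE.
Qed.

End SpanFinite.

Section TernaryQuadricIdeal.
Import TernaryNotations.
Context {k : fieldType}.
Local Notation K := {mpoly k[3]}.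
Implicit Types (f g : K).
Variables (a b c : k).
Hypotheses (a0 : a != 0) (b0 : b != 0) (c0 : c != 0).
Local Notation p := (quad5 a b c).
Local Notation theta := (theta a b c).

Definition quad5_ideal : ideal K := Defs.span (fun f : K^o => exists i, f = p i).
Local Notation I := quad5_ideal.

Lemma theta_scalar : scalar theta.
Proof. by move=> e f g; rewrite /theta !mcoeffD !mcoeffZ; gen_mcoeff; ring. Qed.

Lemma mcoeff3_1 i j l : (1 : K).@[i, j, l] = ((i == 0%N) && (j == 0%N) && (l == 0%N))%:R.
Proof.
rewrite mcoeff1 -mdeg_eq0 mdeg_mnm3 !addn_eq0.
by [].
Qed.

Lemma mpolyX_mnm3 i j l : 'X_[mnm3 i j l] = x ^+ i * y ^+ j * z ^+ l :> K.
Proof.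
rewrite !mpolyXn -!mpolyXD; congr 'X_[_].
by rewrite [RHS]mnm3E; congr mnm3;
  rewrite !mnmDE !mulmnE !mnm1E -!val_eqE /= !inordK //= ?muln1 ?muln0 ?mul1n ?mul0n ?addn0 ?add0n.
Qed.

Lemma mnm_split n (m : 'X_{1..n}) d : (d <= mdeg m)%N ->
  exists m1 m2 : 'X_{1..n}, m = (m1 + m2)%MM /\ mdeg m1 = d.
Proof.
elim: d => [|d IHd] hd; first by exists 0%MM, m; rewrite add0m mdeg0.
have [m1 [m2 [mE m1d]]] := IHd (ltnW hd).
case: (pickP (fun i => m2 i != 0%N)) => [i m2i|m20]; last first.
  move: hd; have -> : m = m1.
    by rewrite mE; apply/mnmP => i; rewrite mnmDE; have /negbFE/eqP-> := m20 i; rewrite addn0.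
  by rewrite m1d ltnn.
exists (m1 + U_(i))%MM, (m2 - U_(i))%MM; rewrite mdegD mdeg1 m1d addn1; split=> //.
rewrite mE -addmA; congr (_ + _)%MM; rewrite addmC submK //.
by apply/mnm_lepP => j; rewrite mnm1E;
    case: eqP => [<-|//]; rewrite lt0n.
Qed.

Lemma order_ideal_sub (J : ideal K) d :
  (forall i j l, (i + j + l)%N = d -> x ^+ i * y ^+ j * z ^+ l \in J) ->
  forall f, order_ge d f -> f \in J.
Proof.
move=> hJ f hf; apply: mpoly_ideal => m fm.
have [|m1 [m2 [-> m1d]]] := @mnm_split 3 m d.
  by rewrite leqNgt; apply: contra fm => /hf->.
rewrite mpolyXD; apply: idealMr; rewrite [m1]mnm3E mpolyX_mnm3; apply: hJ.
by rewrite -mdeg_mnm3 -mnm3E.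
Qed.

Lemma ideal_cancel (J : ideal K) (e : k) f g :
  e != 0 -> g \in J -> e%:MP * f + g \in J -> f \in J.
Proof.
move=> e0 Jg Jfg; have -> : f = (e^-1)%:MP * (e%:MP * f + g - g).
  by rewrite addrK mulrA -mpolyCM mulVf // mul1r.
by apply/idealM/ideal_sub.
Qed.

Lemma mem_eq (J : ideal K) f g : f \in J -> f = g -> g \in J.
Proof. by move=> Jf <-. Qed.

Lemma quad5_mem i : p i \in I.
Proof. by apply: mem_span; exists i. Qed.

Lemma yz_mem : y * z \in I. Proof. exact: (quad5_mem (@Ordinal 5 0 isT)). Qed.
Lemma xz_mem : x * z \in I. Proof. exact: (quad5_mem (@Ordinal 5 1 isT)). Qed.
Lemma xy_mem : x * y \in I. Proof. exact: (quad5_mem (@Ordinal 5 2 isT)). Qed.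
Lemma xx_yy_mem : a%:MP * (x * x) - b%:MP * (y * y) \in I.
Proof. exact: (quad5_mem (@Ordinal 5 3 isT)). Qed.
Lemma xx_zz_mem : a%:MP * (x * x) - c%:MP * (z * z) \in I.
Proof. exact: (quad5_mem (@Ordinal 5 4 isT)). Qed.

Lemma x3_mem : x ^+ 3 \in I.
Proof.
apply: (ideal_cancel a0 (g := - (b%:MP * y) * (x * y))).
  by apply/idealM/xy_mem.
have -> : a%:MP * x ^+ 3 + - (b%:MP * y) * (x * y)
  = x * (a%:MP * (x * x) - b%:MP * (y * y)) :> K by ring.
exact/idealM/xx_yy_mem.
Qed.

Lemma y3_mem : y ^+ 3 \in I.
Proof.
apply: (ideal_cancel b0 (g := - (a%:MP * x) * (x * y))).
  by apply/idealM/xy_mem.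
have -> : b%:MP * y ^+ 3 + - (a%:MP * x) * (x * y)
  = - y * (a%:MP * (x * x) - b%:MP * (y * y)) :> K by ring.
exact/idealM/xx_yy_mem.
Qed.

Lemma z3_mem : z ^+ 3 \in I.
Proof.
apply: (ideal_cancel c0 (g := - (a%:MP * x) * (x * z))).
  by apply/idealM/xz_mem.
have -> : c%:MP * z ^+ 3 + - (a%:MP * x) * (x * z)
  = - z * (a%:MP * (x * x) - c%:MP * (z * z)) :> K by ring.
exact/idealM/xx_zz_mem.
Qed.

(** A monomial of degree 3 is a cube or is divisible by one of xy, xz, yz. *)
Lemma order3_quad5 f : order_ge 3 f -> f \in I.
Proof.
apply: order_ideal_sub => -[|i] [|j] [|l] // ijl.
- by rewrite !mul1r (_ : l.+1 = 3%N); [exact: z3_mem|].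
- by rewrite mul1r mulr1 (_ : j.+1 = 3%N); [exact: y3_mem|rewrite -ijl addn0].
- have -> : x ^+ 0 * y ^+ j.+1 * z ^+ l.+1 = (y ^+ j * z ^+ l) * (y * z) :> K.
    by rewrite ?expr0 !exprS; ring.
  exact/idealM/yz_mem.
- by rewrite !mulr1 (_ : i.+1 = 3%N); [exact: x3_mem|rewrite -ijl !addn0].
- have -> : x ^+ i.+1 * y ^+ 0 * z ^+ l.+1 = (x ^+ i * z ^+ l) * (x * z) :> K.
    by rewrite ?expr0 !exprS; ring.
  exact/idealM/xz_mem.
- have -> : x ^+ i.+1 * y ^+ j.+1 * z ^+ 0 = (x ^+ i * y ^+ j) * (x * y) :> K.
    by rewrite ?expr0 !exprS; ring.
  exact/idealM/xy_mem.
have -> : x ^+ i.+1 * y ^+ j.+1 * z ^+ l.+1 = (x ^+ i * y ^+ j * z ^+ l.+1) * (x * y) :> K.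
    by rewrite ?expr0 !exprS; ring.
exact/idealM/xy_mem.
Qed.

(** There are fifteen products of two of the quadrics and fifteen quartic monomials. Products of the
    mixed terms give six of these; one mixed term times a difference gives those with an exponent 3.
    Then x^4 comes from the product of the two differences, and y^4, z^4 from their squares. *)
Lemma order4_quad5 f : order_ge 4 f -> f \in mul_ideal I I.
Proof.
have J22 : y * y * z * z \in mul_ideal I I.
  by apply: (mem_eq (mem_mul_ideal yz_mem yz_mem)); ring.
have J13 : x * x * z * z \in mul_ideal I I.
  by apply: (mem_eq (mem_mul_ideal xz_mem xz_mem)); ring.
have J12 : x * x * y * y \in mul_ideal I I.
  by apply: (mem_eq (mem_mul_ideal xy_mem xy_mem)); ring.
have Jz : x * y * z * z \in mul_ideal I I.
  by apply: (mem_eq (mem_mul_ideal xz_mem yz_mem)); ring.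
have Jy : x * y * y * z \in mul_ideal I I.
  by apply: (mem_eq (mem_mul_ideal xy_mem yz_mem)); ring.
have Jx : x * x * y * z \in mul_ideal I I.
  by apply: (mem_eq (mem_mul_ideal xy_mem xz_mem)); ring.
have J310 : x * x * x * y \in mul_ideal I I.
  apply: (ideal_cancel a0 (g := - c%:MP * (x * y * z * z))); first exact: idealM.
  by apply: (mem_eq (mem_mul_ideal xy_mem xx_zz_mem)); ring.
have J301 : x * x * x * z \in mul_ideal I I.
  apply: (ideal_cancel a0 (g := - b%:MP * (x * y * y * z))); first exact: idealM.
  by apply: (mem_eq (mem_mul_ideal xz_mem xx_yy_mem)); ring.
have bN0 : - b != 0 by rewrite oppr_eq0.
have cN0 : - c != 0 by rewrite oppr_eq0.
have J130 : x * y * y * y \in mul_ideal I I.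
  apply: (ideal_cancel bN0 (g := a%:MP * (x * x * x * y))); first exact: idealM.
  by apply: (mem_eq (mem_mul_ideal xy_mem xx_yy_mem)); rewrite mpolyCN; ring.
have J031 : y * y * y * z \in mul_ideal I I.
  apply: (ideal_cancel bN0 (g := a%:MP * (x * x * y * z))); first exact: idealM.
  by apply: (mem_eq (mem_mul_ideal yz_mem xx_yy_mem)); rewrite mpolyCN; ring.
have J103 : x * z * z * z \in mul_ideal I I.
  apply: (ideal_cancel cN0 (g := a%:MP * (x * x * x * z))); first exact: idealM.
  by apply: (mem_eq (mem_mul_ideal xz_mem xx_zz_mem)); rewrite mpolyCN; ring.
have J013 : y * z * z * z \in mul_ideal I I.
  apply: (ideal_cancel cN0 (g := a%:MP * (x * x * y * z))); first exact: idealM.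
  by apply: (mem_eq (mem_mul_ideal yz_mem xx_zz_mem)); rewrite mpolyCN; ring.
have J400 : x * x * x * x \in mul_ideal I I.
  apply: (@ideal_cancel _ (a * a) _
    (- (a * b)%:MP * (x * x * y * y) + (- (a * c)%:MP * (x * x * z * z)
     + (b * c)%:MP * (y * y * z * z)))); first by rewrite mulf_neq0.
    by apply: idealD; [apply/idealM/J12|apply: idealD; [apply/idealM/J13|apply/idealM/J22]].
  by apply: (mem_eq (mem_mul_ideal xx_yy_mem xx_zz_mem)); rewrite !mpolyCM; ring.
have J040 : y * y * y * y \in mul_ideal I I.
  apply: (@ideal_cancel _ (b * b) _
    (- (a * b + a * b)%:MP * (x * x * y * y) + (a * a)%:MP * (x * x * x * x))).
  - by rewrite mulf_neq0.
  - by apply: idealD; [apply/idealM/J12|apply/idealM/J400].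
  by apply: (mem_eq (mem_mul_ideal xx_yy_mem xx_yy_mem)); rewrite mpolyCD !mpolyCM; ring.
have J004 : z * z * z * z \in mul_ideal I I.
  apply: (@ideal_cancel _ (c * c) _
    (- (a * c + a * c)%:MP * (x * x * z * z) + (a * a)%:MP * (x * x * x * x))).
  - by rewrite mulf_neq0.
  - by apply: idealD; [apply/idealM/J13|apply/idealM/J400].
  by apply: (mem_eq (mem_mul_ideal xx_zz_mem xx_zz_mem)); rewrite mpolyCD !mpolyCM; ring.
apply: order_ideal_sub => i j l ijl.
have -> : l = (4 - i - j)%N by rewrite -ijl -addnA addKn addKn.
have {ijl} : (i + j <= 4)%N by rewrite -ijl leq_addr.
have xyz4 i' j' l' g : g \in mul_ideal I I -> g = x ^+ i' * y ^+ j' * z ^+ l' ->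
  x ^+ i' * y ^+ j' * z ^+ l' \in mul_ideal I I by move=> Jg <-.
case: i => [|[|[|[|[|//]]]]]; case: j => [|[|[|[|[|//]]]]] // _.
- by apply: (@xyz4 0%N 0%N 4%N _ J004); ring.
- by apply: (@xyz4 0%N 1%N 3%N _ J013); ring.
- by apply: (@xyz4 0%N 2%N 2%N _ J22); ring.
- by apply: (@xyz4 0%N 3%N 1%N _ J031); ring.
- by apply: (@xyz4 0%N 4%N 0%N _ J040); ring.
- by apply: (@xyz4 1%N 0%N 3%N _ J103); ring.
- by apply: (@xyz4 1%N 1%N 2%N _ Jz); ring.
- by apply: (@xyz4 1%N 2%N 1%N _ Jy); ring.
- by apply: (@xyz4 1%N 3%N 0%N _ J130); ring.
- by apply: (@xyz4 2%N 0%N 2%N _ J13); ring.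
- by apply: (@xyz4 2%N 2%N 0%N _ J12); ring.
- by apply: (@xyz4 3%N 0%N 1%N _ J301); ring.
- by apply: (@xyz4 3%N 1%N 0%N _ J310); ring.
- by apply: (@xyz4 4%N 0%N 0%N _ J400); ring.
Qed.

End TernaryQuadricIdeal.

(** * Duality of k[x,y,z]/I under theta, and linear syzygies *)

Section Apolarity.
Import TernaryNotations.
Context {k : fieldType}.
Local Notation K := {mpoly k[3]}.
Implicit Types (f g : K).
Variables (a b c : k).
Hypotheses (a0 : a != 0) (b0 : b != 0) (c0 : c != 0).
Local Notation p := (quad5 a b c).
Local Notation theta := (theta a b c).
Local Notation I := (quad5_ideal a b c).

Lemma order_ge3P d f :
  (forall i j l, (i + j + l < d)%N -> f.@[i, j, l] = 0) -> order_ge d f.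
Proof.
move=> h m hm; rewrite [m]mnm3E; apply: h.
by rewrite -mdeg_mnm3 -mnm3E.
Qed.

(** A combination [q] of the five quadrics has the same quadratic part as f, so f - q has order 3
    and lies in [I]. *)
Lemma apolar_quad5 f :
  f.@[0, 0, 0] = 0 -> f.@[1, 0, 0] = 0 -> f.@[0, 1, 0] = 0 -> f.@[0, 0, 1] = 0 ->
  theta f = 0 -> f \in I.
Proof.
move=> f0 f1 f2 f3 th.
(* The last two coefficients match y^2 and z^2; the coefficient of x^2 then agrees because theta f =
   0, which is [alE]. *)
pose q := (f.@[0, 1, 1])%:MP * (y * (z * 1)) + (f.@[1, 0, 1])%:MP * (x * (z * 1))
  + (f.@[1, 1, 0])%:MP * (x * (y * 1))
  + (- (f.@[0, 2, 0] / b))%:MP * (a%:MP * (x * (x * 1)) - b%:MP * (y * (y * 1)))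
  + (- (f.@[0, 0, 2] / c))%:MP * (a%:MP * (x * (x * 1)) - c%:MP * (z * (z * 1))).
have Iq : q \in I.
  rewrite /q !mulr1.
  apply: idealD; last by apply/idealM/xx_zz_mem.
  apply: idealD; last by apply/idealM/xx_yy_mem.
  apply: idealD; last by apply/idealM/xy_mem.
  by apply: idealD; [apply/idealM/yz_mem|apply/idealM/xz_mem].
have -> : f = q + (f - q) by rewrite addrC subrK.
apply: idealD => //; apply: order3_quad5 => //; apply: order_ge3P.
have alE : f.@[2, 0, 0] = - a * (f.@[0, 2, 0] / b) - a * (f.@[0, 0, 2] / c).
  have : f.@[2, 0, 0] = a * (theta f - f.@[0, 2, 0] / b - f.@[0, 0, 2] / c).
    by rewrite /theta; gen_mcoeff; field; rewrite a0 b0 c0.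
  by rewrite th => ->; gen_mcoeff; ring.
move=> [|[|[|i]]] [|[|[|j]]] [|[|[|l]]] // _;
  rewrite /q !mcoeff3E ?mcoeff3_1 /= ?f0 ?f1 ?f2 ?f3 ?alE;
  gen_mcoeff; by field; rewrite ?b0 ?c0.
Qed.

Lemma theta_quad5 f i : theta (f * p i) = 0.
Proof.
rewrite mulrC /theta; case: i => [[|[|[|[|[|//]]]]] lt_i]; rewrite /quad5 /=;
  rewrite ?mulrDl ?mulNr -!mulrA !mcoeff3E; gen_mcoeff; field; by rewrite ?a0 ?b0 ?c0.
Qed.

Definition thetaL := mk_scalar (theta_scalar a b c).

Lemma theta_quad5_ideal f g : g \in I -> theta (f * g) = 0.
Proof.
move=> /span_finP[r ->]; rewrite mulr_sumr -[LHS]/(thetaL _) raddf_sum big1 // => i _.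
by rewrite /= [_ *: _]mulrC [_ * r i]mulrC mulrA theta_quad5.
Qed.

(** Testing with x^2, x, y, z isolates the constant and linear coefficients of g, and testing with 1
    gives theta g = 0. *)
Lemma theta_nondeg g : (forall f, theta (f * g) = 0) -> g \in I.
Proof.
move=> h; apply: apolar_quad5.
- have := h (x * x); rewrite /theta -!mulrA !mcoeff3E => /eqP.
  by rewrite !mul0r !addr0 mulf_eq0 invr_eq0 (negPf a0) orbF => /eqP.
- have := h x; rewrite /theta !mcoeff3E => /eqP.
  by rewrite !mul0r !addr0 mulf_eq0 invr_eq0 (negPf a0) orbF => /eqP.
- have := h y; rewrite /theta !mcoeff3E => /eqP.
  by rewrite !mul0r !addr0 add0r mulf_eq0 invr_eq0 (negPf b0) orbF => /eqP.
- have := h z; rewrite /theta !mcoeff3E => /eqP.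
  by rewrite !mul0r !add0r mulf_eq0 invr_eq0 (negPf c0) orbF => /eqP.
- by have := h 1; rewrite mul1r.
Qed.

(* [theta] generates the dual of the Gorenstein algebra K/I; the formula is read
   off the basis 1, x, y, z, x^2. *)
Definition theta_repr (mu : K -> k) : K :=
  (a * mu (x * x))%:MP + (a * mu x)%:MP * x + (b * mu y)%:MP * y
  + (c * mu z)%:MP * z + (a * mu 1)%:MP * (x * x).

Lemma theta_reprP (mu : {scalar K}) : (forall g, g \in I -> mu g = 0) ->
  forall g, theta (theta_repr mu * g) = mu g.
Proof.
move=> muI g.
(* The normal form of g in the basis 1, x, y, z, x^2 of K/I. Since theta (x^2) = 1/a, the last
   coefficient must be a theta(g). *)
pose nf := g.@[0, 0, 0] *: 1 + g.@[1, 0, 0] *: (x * 1) + g.@[0, 1, 0] *: (y * 1)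
  + g.@[0, 0, 1] *: (z * 1) + (a * theta g) *: (x * (x * 1)).
have gnf : g - nf \in I.
  apply: apolar_quad5; rewrite /nf /theta !mcoeff3E ?mcoeff3_1 /=; gen_mcoeff;
    by field; rewrite ?a0 ?b0 ?c0.
have thD u v : theta (u + v) = theta u + theta v by rewrite -[LHS]/(thetaL _) raddfD.
have thZ e u : theta (e *: u) = e * theta u by rewrite -[LHS]/(thetaL _) linearZ.
have muD u v : mu (u + v) = mu u + mu v by rewrite raddfD.
have muZ e u : mu (e *: u) = e * mu u by rewrite linearZ.
set R := theta_repr mu.
have RE : R = (a * mu (x * x))%:MP * 1 + (a * mu x)%:MP * (x * 1)
    + (b * mu y)%:MP * (y * 1) + (c * mu z)%:MP * (z * 1)
    + (a * mu 1)%:MP * (x * (x * 1)) by rewrite !mulr1.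
have th1 : theta R = mu 1.
  rewrite RE /theta !mcoeff3E !mcoeff3_1 /=.
  by move: (mu 1) (mu x) (mu y) (mu z) (mu (x * x)) => *; field; rewrite ?a0 ?b0 ?c0.
have thx : theta (R * x) = mu x.
  rewrite [R * _]mulrC RE /theta !mcoeff3E !mcoeff3_1 /=.
  by move: (mu 1) (mu x) (mu y) (mu z) (mu (x * x)) => *; field; rewrite ?a0 ?b0 ?c0.
have thy : theta (R * y) = mu y.
  rewrite [R * _]mulrC RE /theta !mcoeff3E !mcoeff3_1 /=.
  by move: (mu 1) (mu x) (mu y) (mu z) (mu (x * x)) => *; field; rewrite ?a0 ?b0 ?c0.
have thz : theta (R * z) = mu z.
  rewrite [R * _]mulrC RE /theta !mcoeff3E !mcoeff3_1 /=.
  by move: (mu 1) (mu x) (mu y) (mu z) (mu (x * x)) => *; field; rewrite ?a0 ?b0 ?c0.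
have thxx : theta (R * (x * x)) = mu (x * x).
  rewrite [R * _]mulrC -mulrA RE /theta !mcoeff3E !mcoeff3_1 /=.
  by move: (mu 1) (mu x) (mu y) (mu z) (mu (x * x)) => *; field; rewrite ?a0 ?b0 ?c0.
have -> : g = nf + (g - nf) by rewrite addrC subrK.
rewrite mulrDr thD muD (theta_quad5_ideal _ gnf) (muI _ gnf).
congr (_ + _); rewrite /nf.
rewrite !mulr1 !mulrDr -!scalerAr !thD !muD !thZ !muZ.
by rewrite thx thy thz thxx [R * 1]mulr1 th1.
Qed.

(** As [cubic5] reads cubic coefficients and p_i is a quadric, only the linear parts of the r_j
    count. The hypothesis kills the constants and leaves five of the fifteen linear coefficients
    free, one for each row of [form5]; after substitution the sum cancels. *)
Lemma quad5_syzygy (r : 'I_5 -> K) (i l : 'I_5) :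
  order_ge 4 (\sum_j r j * p j) -> \sum_j cubic5 a b c j l (r j * p i) = 0.
Proof.
move=> h.
have coef u v w : (u + v + w < 4)%N -> (\sum_j p j * r j).@[u, v, w] = 0.
  by move=> uvw; under eq_bigr => j _ do rewrite mulrC; apply: h; rewrite mdeg_mnm3.
move: coef; rewrite !big_ord_recl !big_ord0 ![r _ * _]mulrC /quad5.
set r0 := r _; set r1 := r _; set r2 := r _; set r3 := r _; set r4 := r _ => coef /=.
clearbody r0 r1 r2 r3 r4; move: coef; rewrite /= ?mulrDl ?mulNr -!mulrA => coef.
(* Each equation below is one vanishing coefficient v, scaled by e so that the unknown t appears
   with coefficient 1. *)
have lin (t u e v : k) : e * v = t - u -> v = 0 -> t = u.
  by move=> tu v0; apply/eqP; rewrite -subr_eq0 -tu v0 mulr0.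
have E0 : r0.@[0, 0, 0] = 0.
  by apply: (lin _ _ 1) (coef 0 1 1 isT)%N; rewrite !mcoeff3E; gen_mcoeff; ring.
have E1 : r1.@[0, 0, 0] = 0.
  by apply: (lin _ _ 1) (coef 1 0 1 isT)%N; rewrite !mcoeff3E; gen_mcoeff; ring.
have E2 : r2.@[0, 0, 0] = 0.
  by apply: (lin _ _ 1) (coef 1 1 0 isT)%N; rewrite !mcoeff3E; gen_mcoeff; ring.
have E3 : r3.@[0, 0, 0] = 0.
  by apply: (lin _ _ (- b^-1)) (coef 0 2 0 isT)%N; rewrite !mcoeff3E; gen_mcoeff; field.
have E4 : r4.@[0, 0, 0] = 0.
  by apply: (lin _ _ (- c^-1)) (coef 0 0 2 isT)%N; rewrite !mcoeff3E; gen_mcoeff; field.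
have E4x : r4.@[1, 0, 0] = - r3.@[1, 0, 0].
  by apply: (lin _ _ a^-1) (coef 3 0 0 isT)%N; rewrite !mcoeff3E; gen_mcoeff; field.
have E3y : r3.@[0, 1, 0] = 0.
  by apply: (lin _ _ (- b^-1)) (coef 0 3 0 isT)%N; rewrite !mcoeff3E; gen_mcoeff; field.
have E4z : r4.@[0, 0, 1] = 0.
  by apply: (lin _ _ (- c^-1)) (coef 0 0 3 isT)%N; rewrite !mcoeff3E; gen_mcoeff; field.
have E2x : r2.@[1, 0, 0] = - a * r4.@[0, 1, 0].
  apply: (lin _ _ 1) (coef 2 1 0 isT)%N.
  by rewrite !mcoeff3E E3y; gen_mcoeff; ring.
have E1x : r1.@[1, 0, 0] = - a * r3.@[0, 0, 1].
  apply: (lin _ _ 1) (coef 2 0 1 isT)%N.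
  by rewrite !mcoeff3E E4z; gen_mcoeff; ring.
have E2y : r2.@[0, 1, 0] = b * r3.@[1, 0, 0].
  by apply: (lin _ _ 1) (coef 1 2 0 isT)%N; rewrite !mcoeff3E; gen_mcoeff; ring.
have E0y : r0.@[0, 1, 0] = b * r3.@[0, 0, 1].
  by apply: (lin _ _ 1) (coef 0 2 1 isT)%N; rewrite !mcoeff3E; gen_mcoeff; ring.
have E1z : r1.@[0, 0, 1] = - c * r3.@[1, 0, 0].
  apply: (lin _ _ 1) (coef 1 0 2 isT)%N.
  by rewrite !mcoeff3E E4x; gen_mcoeff; ring.
have E0z : r0.@[0, 0, 1] = c * r4.@[0, 1, 0].
  by apply: (lin _ _ 1) (coef 0 1 2 isT)%N; rewrite !mcoeff3E; gen_mcoeff; ring.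
have E2z : r2.@[0, 0, 1] = - r0.@[1, 0, 0] - r1.@[0, 1, 0].
  by apply: (lin _ _ 1) (coef 1 1 1 isT)%N; rewrite !mcoeff3E; gen_mcoeff; ring.
clear coef; case: i => [[|[|[|[|[|//]]]]] lt_i]; case: l => [[|[|[|[|[|//]]]]] lt_l];
  rewrite /cubic5 /= ?mulrDl ?mulNr -?mulrA ?mcoeff3E
    ?(E0, E1, E2, E3, E4, E4x, E3y, E4z, E2x, E1x, E2y, E0y, E1z, E0z, E2z);
  gen_mcoeff; field; rewrite ?a0 ?b0 ?c0 //.
Qed.

End Apolarity.

Section QuadricOrder.
Import TernaryNotations.
Context {k : fieldType}.
Local Notation K := {mpoly k[3]}.
Implicit Types (f g : K).
Variables (a b c : k).
Local Notation I := (quad5_ideal a b c).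

Lemma quad5_order2 f : f \in I -> order_ge 2 f.
Proof.
move=> /span_finP[r ->]; apply/order_idealP/ideal_sum => i _; apply: idealM.
have p2 u v : order_ge 2 ('X_u * 'X_v : K).
  by apply: (@order_geM _ _ 1 1); apply: order_geX; rewrite mdeg1.
have o2 (e : k) g : order_ge 2 g -> e%:MP * g \in order_ideal 2.
  by move=> hf; apply/idealM/order_idealP.
by case: i => [[|[|[|[|[|//]]]]] lt_i]; rewrite /quad5 [nth _ _ _]/=;
  [apply/order_idealP|apply/order_idealP|apply/order_idealP|apply: ideal_sub|apply: ideal_sub];
  rewrite ?o2.
Qed.

Lemma cubic5_scalar i j : scalar (cubic5 a b c i j).
Proof.
move=> e f g; rewrite /cubic5; case: i => [[|[|[|[|[|//]]]]] lt_i];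
  case: j => [[|[|[|[|[|//]]]]] lt_l] /=;
  rewrite ?mcoeffD ?mcoeffZ; gen_mcoeff; ring.
Qed.

Lemma cubic5_order i j f : order_ge 4 f -> cubic5 a b c i j f = 0.
Proof.
move=> hf; rewrite /cubic5; case: i => [[|[|[|[|[|//]]]]] lt_i];
  case: j => [[|[|[|[|[|//]]]]] lt_l] //=;
  by rewrite !hf ?mdeg_mnm3 // ?oppr0 ?mul0r ?addr0.
Qed.

End QuadricOrder.

(** * Transfer from ternary forms to P: the elements w and H *)

Section Linkage.
Import TernaryNotations.
Context {k : fieldType} {n s : nat}.
Local Notation P := {mpoly k[n]}.
Local Notation K := {mpoly k[3]}.
Variables (a b c : k).
Hypotheses (a0 : a != 0) (b0 : b != 0) (c0 : c != 0).
Local Notation p := (quad5 a b c).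
Local Notation theta := (theta a b c).
Local Notation I := (quad5_ideal a b c).

Variables (sigma : {rmorphism P -> K}) (iota : {rmorphism K -> P}) (Y : 'I_s -> P).
Hypothesis sigmaZ : forall e f, sigma (e *: f) = e *: sigma f.
Hypothesis iotaZ : forall e f, iota (e *: f) = e *: iota f.
Hypothesis iotaK : forall f, sigma (iota f) = f.
Hypothesis sigma_order : forall d f, order_ge d f -> order_ge d (sigma f).
Hypothesis sigmaY : forall j, sigma (Y j) = 0.
Hypothesis sigma_ker : forall f, sigma f = 0 -> exists u, f = \sum_j u j * Y j.

Variables (A B' B : ideal P).
Hypothesis B'P : forall f, f \in B' <-> exists r : 'I_5 -> P, f = \sum_i r i * iota (p i).
Hypothesis BP : forall f, f \in B <->
  exists (f' : P) (u : 'I_s -> P), f' \in B' /\ f = f' + \sum_j u j * Y j.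

Variables (N : nat) (Lam : {scalar P}).
Hypothesis A_order : forall f, f \in A -> order_ge 5 f.
Hypothesis A_bound : forall f, order_ge N f -> f \in A.
Hypothesis LamA : forall f : P, f \in A -> Lam f = 0.
Hypothesis Lam_nondeg : forall f : P, (forall g, Lam (f * g) = 0) -> f \in A.

Lemma LamB f g : Lam (f - g) = Lam f - Lam g.
Proof. exact: raddfB. Qed.

Lemma LamM_sum (T : Type) (r : seq T) (F : T -> P) g :
  Lam ((\sum_(i <- r) F i) * g) = \sum_(i <- r) Lam (F i * g).
Proof. by rewrite mulr_suml; apply: raddf_sum. Qed.

Lemma B'_sub f : f \in B' -> f \in B.
Proof.
move=> Bf; apply/BP; exists f, (fun=> 0); split=> //.
by rewrite big1 ?addr0 // => j _; rewrite mul0r.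
Qed.

Lemma iota_p_mem i : iota (p i) \in B'.
Proof.
apply/B'P; exists (fun j => (j == i)%:R).
by rewrite (bigD1 i) //= eqxx mul1r big1 ?addr0 // => j /negPf->; rewrite mul0r.
Qed.

Lemma Y_mem j : Y j \in B.
Proof.
apply/BP; exists 0, (fun j' => (j' == j)%:R); split; first exact: ideal0.
by rewrite add0r (bigD1 j) //= eqxx mul1r big1 ?addr0 // => j' /negPf->; rewrite mul0r.
Qed.

Lemma sigma_ker_mem f : sigma f = 0 -> f \in B.
Proof. by move=> /sigma_ker[u ->]; apply: ideal_sum => j _; apply/idealM/Y_mem. Qed.

Lemma B'_sigma f : f \in B' -> sigma f \in I.
Proof.
move=> /B'P[r ->]; rewrite rmorph_sum; apply: ideal_sum => i _.
by rewrite rmorphM iotaK; apply/idealM/quad5_mem.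
Qed.

Lemma iota_mem f : f \in I -> iota f \in B'.
Proof.
move=> /span_finP[r ->]; rewrite rmorph_sum; apply: ideal_sum => i _.
by rewrite [_ *: _]/(_ * _) rmorphM; apply/idealM/iota_p_mem.
Qed.

Lemma B_sigma f : f \in B <-> sigma f \in I.
Proof.
split=> [/BP[f' [u [Bf' ->]]]|If].
  rewrite rmorphD rmorph_sum big1 ?addr0; first exact: B'_sigma.
  by move=> j _; rewrite rmorphM sigmaY mulr0.
have -> : f = iota (sigma f) + (f - iota (sigma f)) by rewrite addrC subrK.
apply: idealD; first exact/B'_sub/iota_mem.
by apply: sigma_ker_mem; rewrite rmorphB iotaK subrr.
Qed.

Lemma B'_mul_order f : f \in mul_ideal B B' -> order_ge 4 (sigma f).
Proof.
move=> /asboolP[d [e [g [gG ->]]]]; rewrite rmorph_sum.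
apply/order_idealP/ideal_sum => i _; rewrite [_ *: _]/(_ * _) rmorphM; apply: idealM.
have [f1 [f2 [/B_sigma Bf1 /B'_sigma Bf2 ->]]] := gG i; rewrite rmorphM.
by apply/order_idealP/(@order_geM _ _ 2 2); [apply: quad5_order2 Bf1|apply: quad5_order2 Bf2].
Qed.

(** Replacing the coefficients of f by their images under iota o sigma changes f by an element of
    (Y) B', which lies in BB'. What remains is iota of an element of I^2, by [order4_quad5]. *)
Lemma order4_mul f : f \in B' -> order_ge 4 (sigma f) -> f \in mul_ideal B B'.
Proof.
move=> /B'P[r fE] of4.
have -> : f = iota (sigma f) + \sum_i (r i - iota (sigma (r i))) * iota (p i).
  rewrite {1}fE [in iota _]fE !rmorph_sum -big_split /=; apply: eq_bigr => i _.
  by rewrite !rmorphM iotaK -mulrDl addrC subrK.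
apply: idealD; last first.
  apply: ideal_sum => i _; apply: mem_mul_ideal (iota_p_mem i).
  by apply: sigma_ker_mem; rewrite rmorphB iotaK subrr.
move: (order4_quad5 a0 b0 c0 of4) => /asboolP[d [e [g [gG ->]]]].
rewrite rmorph_sum; apply: ideal_sum => i _.
rewrite [_ *: _]/(_ * _) rmorphM; apply: idealM.
have [f1 [f2 [If1 If2 ->]]] := gG i; rewrite rmorphM.
by apply: mem_mul_ideal; [apply/B'_sub|]; apply: iota_mem.
Qed.

Lemma A_sub_mul (f : P) (r : 'I_5 -> P) (u : 'I_s -> P) :
  \sum_i r i * iota (p i) + \sum_j u j * Y j \in A ->
  \sum_i r i * iota (p i) \in mul_ideal B B'.
Proof.
move=> /A_order/sigma_order; rewrite rmorphD [X in _ + X]rmorph_sum [X in _ + X]big1.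
  rewrite addr0 => h; apply: order4_mul; first by apply/B'P; exists r.
  by move=> m hm; apply: h; apply: leq_trans hm _.
by move=> j _; rewrite rmorphM sigmaY mulr0.
Qed.

(** The quadric yz lies in B, so f yz lies in A and has order 5. Hence sigma f has order 3, and [I]
    contains everything of that order. *)
Lemma colon_sub_B f : f \in colon A B -> f \in B.
Proof.
move=> /colonP fB; apply/B_sigma/order3_quad5 => //; apply: order_ge3P => i j l ijl.
have /fB/A_order/sigma_order : iota (y * z) \in B.
  by apply/B'_sub/iota_mem/yz_mem.
rewrite rmorphM iotaK mulrC => /(_ (mnm3 i j.+1 l.+1)).
rewrite -mulrA !mcoeff3E; apply.
by rewrite mdeg_mnm3 !(addnS, addSn).
Qed.

(** Because [sigma] preserves order, mu o sigma kills A and is represented through Lam. *)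
Lemma scalar_sigma_repr (mu : {scalar K}) : (forall f, order_ge 5 f -> mu f = 0) ->
  exists h, forall g, Lam (h * g) = mu (sigma g).
Proof.
move=> mu5; have lin : scalar (fun g => mu (sigma g)).
  by move=> e f g; rewrite rmorphD sigmaZ linearP.
apply: (functional_repr A_bound LamA Lam_nondeg (mu := mk_scalar lin)) => f Af /=.
by apply/mu5/sigma_order/A_order.
Qed.

Lemma dual_generator : exists w, forall g, Lam (w * g) = theta (sigma g).
Proof.
apply: (scalar_sigma_repr (mu := thetaL a b c)) => f hf /=.
by rewrite /theta !hf ?mdeg_mnm3 // !mul0r !addr0.
Qed.

Lemma dual_cubics : exists H : 'I_5 -> 'I_5 -> P,
  forall j l g, Lam (H j l * g) = cubic5 a b c j l (sigma g).
Proof.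
have ex (jl : 'I_5 * 'I_5) : exists h,
    forall g, Lam (h * g) = cubic5 a b c jl.1 jl.2 (sigma g).
  apply: (scalar_sigma_repr (mu := mk_scalar (cubic5_scalar a b c jl.1 jl.2))) => f hf /=.
  by apply: cubic5_order => m hm; apply: hf; apply: leq_trans hm _.
have [H HE] := choice ex; exists (fun j l => H (j, l)) => j l g.
exact: (HE (j, l)).
Qed.

Section DualElements.
Import TernaryNotations.
Variables (w : P) (H : 'I_5 -> 'I_5 -> P).
Hypothesis wE : forall g, Lam (w * g) = theta (sigma g).
Hypothesis HE : forall j l g, Lam (H j l * g) = cubic5 a b c j l (sigma g).

Lemma w_colon f : f \in B -> w * f \in A.
Proof.
move=> /B_sigma If; apply: Lam_nondeg => g.
by rewrite -mulrA wE rmorphM mulrC theta_quad5_ideal.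
Qed.

Lemma w_mul_colon (e : P) : e * w \in colon A B.
Proof. by apply/colonP => f Bf; rewrite -mulrA; apply/idealM/w_colon. Qed.

Lemma w_nondeg f : w * f \in A -> f \in B.
Proof.
move=> wf; apply/B_sigma/(theta_nondeg a0 b0 c0) => g.
by rewrite -[g]iotaK -rmorphM -wE mulrCA; apply/LamA/idealM.
Qed.

(** The functional Lam(f iota(.)) on k[x,y,z] kills [I], hence is a multiple theta(R .) of theta; so
    f agrees with iota(R) w under Lam. *)
Lemma colon_w f : f \in colon A B -> exists x, f - x * w \in A.
Proof.
move=> /colonP fB.
have lin : scalar (fun g => Lam (f * iota g)).
  by move=> e g g'; rewrite rmorphD iotaZ mulrDr -mul_mpolyC mulrCA mul_mpolyC linearP.
pose mu := mk_scalar lin.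
exists (iota (theta_repr a b c mu)); apply: Lam_nondeg => g.
have muI g' : g' \in I -> mu g' = 0.
  by move=> Ig'; apply/LamA/fB/B'_sub/iota_mem.
rewrite mulrBl LamB [_ * w]mulrC -mulrA wE rmorphM iotaK theta_reprP //.
apply/eqP; rewrite -LamB -mulrBr; apply/eqP/LamA/fB.
by apply: sigma_ker_mem; rewrite rmorphB iotaK subrr.
Qed.

Lemma colonK f : (forall g, g \in colon A B -> f * g \in A) -> f \in B.
Proof.
by move=> h; apply: w_nondeg; rewrite mulrC; apply: h; rewrite -[w]mul1r w_mul_colon.
Qed.

Lemma H_form5 j i :
  \sum_l H j l * iota (form5 a b c l i) - (if j == i then w else 0) \in A.
Proof.
apply: Lam_nondeg => g; rewrite mulrBl LamB LamM_sum.
under eq_bigr => l _ do rewrite -mulrA HE rmorphM iotaK.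
rewrite cubic5_form5 //; case: eqP => _; first by rewrite wE subrr.
by rewrite mul0r raddf0 subr0.
Qed.

(** Multiply by f in B and pair with g. As sigma f is a sum of t_i p_i, the pairing splits into the
    sums of [quad5_syzygy] for the coefficients r_j t_i g; their combination with the p_j still has
    order 4. *)
Lemma H_colon (r : 'I_5 -> P) l :
  \sum_j r j * iota (p j) \in mul_ideal B B' -> \sum_j r j * H j l \in colon A B.
Proof.
move=> /B'_mul_order; rewrite rmorph_sum.
under eq_bigr => j _ do rewrite rmorphM iotaK.
move=> h4; apply/colonP => f /B_sigma/span_finP[t fE]; apply: Lam_nondeg => g.
rewrite -mulrA LamM_sum.
under eq_bigr => j _.
  rewrite [r j * _]mulrC -mulrA HE !rmorphM fE mulr_suml mulr_sumr.
  rewrite -[cubic5 _ _ _ _ _ _]/(mk_scalar (cubic5_scalar a b c j l) _) raddf_sum.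
  over.
rewrite exchange_big big1 //= => i _.
rewrite -[RHS](@quad5_syzygy _ _ _ _ a0 b0 c0 (fun j => sigma (r j) * (t i * sigma g)) i l).
  apply: eq_bigr => j _; congr (cubic5 _ _ _ _ _ _).
  by rewrite -[RHS]mulrA; congr (_ * _); apply: mulrAC.
under eq_bigr => j _ do rewrite mulrAC.
rewrite -mulr_suml; exact: (@order_geM _ _ 4 0).
Qed.

End DualElements.

Theorem linked_second_syzygy :
  exists ann_B'BB' : annihilates (colon A B) (subquo B' (mul_ideal B B')),
    second_syzygy_has_summand (canonical_module A B) (over_qring ann_B'BB').
Proof.
have [w wE] := dual_generator.
have [H HE] := dual_cubics.
have [t [G [G_rel G_gen]]] :=
  relations_fin_gen (gens (fun i => iota (p i)) Y) A_bound.
apply: (@second_syzygy_splits P A B' B 5 s t (fun i => iota (p i)) Y w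
  (fun l i => iota (form5 a b c l i)) H G).
- exact: B'P.
- exact: BP.
- exact: colon_sub_B.
- exact: A_sub_mul.
- exact: (w_mul_colon wE).
- exact: (w_nondeg wE).
- exact: (colon_w wE).
- exact: (colonK wE).
- move=> l; rewrite -[RHS](rmorph0 iota) -(form5_quad5 a b c l) rmorph_sum.
  by apply: eq_bigr => i _; rewrite rmorphM.
- exact: (H_form5 wE HE).
- exact: (H_colon HE).
- exact: G_rel.
- exact: G_gen.
Qed.

End Linkage.

(** * Orthogonal bases of nondegenerate symmetric forms in three variables, in every
    characteristic *)

Lemma ord3_ind (Q : 'I_3 -> Prop) :
  Q (var3 0) -> Q (var3 1) -> Q (var3 2) -> forall i, Q i.
Proof.
move=> Q0 Q1 Q2 i; have -> : i = var3 i by rewrite /var3 inord_val.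
by case: i => [[|[|[|//]]] lt_i].
Qed.

Lemma sum_ord3 (V : nmodType) (F : 'I_3 -> V) :
  \sum_i F i = F (var3 0) + F (var3 1) + F (var3 2).
Proof.
rewrite !big_ord_recl big_ord0 addr0 addrA; congr (F _ + F _ + F _);
  by apply: val_inj; rewrite /= inordK.
Qed.

Section OrthogonalBasis.
Context {k : fieldType} (G : 'M[k]_3).
Hypotheses (symG : G^T = G) (unitG : G \in unitmx).

Local Notation beta u v := ((u *m G *m v^T) 0 0).

Implicit Types (u v : 'rV[k]_3) (e : k).

Lemma betaC (u v : 'rV[k]_3) : beta u v = beta v u.
Proof.
have -> : v *m G *m u^T = (u *m G *m v^T)^T.
  by rewrite !trmx_mul trmxK symG mulmxA.
by rewrite [RHS]mxE.
Qed.

Lemma betaDl u1 u2 v : beta (u1 + u2) v = beta u1 v + beta u2 v.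
Proof. by rewrite !mulmxDl mxE. Qed.

Lemma betaDr u v1 v2 : beta u (v1 + v2) = beta u v1 + beta u v2.
Proof. by rewrite [LHS]betaC betaDl; congr (_ + _); apply: betaC. Qed.

Lemma betaZl e u v : beta (e *: u) v = e * beta u v.
Proof. by rewrite -!scalemxAl mxE. Qed.

Lemma betaZr e u v : beta u (e *: v) = e * beta u v.
Proof. by rewrite [LHS]betaC betaZl; congr (_ * _); apply: betaC. Qed.

Lemma beta_nondeg (u : 'rV[k]_3) : u != 0 -> exists v, beta u v != 0.
Proof.
move=> u0; apply: contrapT => no; case/eqP: u0.
rewrite -[u](mulmxK unitG); suff -> : u *m G = 0 by rewrite mul0mx.
apply/rowP => j; rewrite [RHS]mxE; apply: contrapT => uj; apply: no.
exists (delta_mx 0 j); rewrite trmx_delta -colE mxE.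
exact/eqP.
Qed.

Lemma ker_row m (M : 'M[k]_(3, m)) : (m < 3)%N -> exists2 v : 'rV_3, v != 0 & v *m M = 0.
Proof.
move=> m3; have : kermx M != 0.
  by rewrite -mxrank_eq0 mxrank_ker subn_eq0 -ltnNge (leq_ltn_trans (rank_leq_col M)).
case/rowV0Pn => v /sub_kermxP vM v0; by exists v.
Qed.

(** Otherwise [G] is alternating of odd size 3. Its kernel contains the vector (G_12, -G_02, G_01),
    which invertibility forces to be 0, and then G = 0. *)
Lemma anisotropic_vector : exists v, beta v v != 0.
Proof.
apply: contrapT => no.
have bz v : beta v v = 0 by apply: contrapT => /eqP vv; apply: no; exists v.
have anti u v : beta u v = - beta v u.
  have := bz (u + v); rewrite betaDl !betaDr !bz add0r addr0 => /eqP.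
  by rewrite addr_eq0 => /eqP.
have Ge i j : beta (delta_mx 0 i : 'rV[k]_3) (delta_mx 0 j : 'rV[k]_3) = G i j.
  by rewrite -rowE trmx_delta -colE !mxE.
have Gd i : G i i = 0 by rewrite -Ge bz.
have Ga i j : G i j = - G j i by rewrite -!Ge anti.
pose c (j : 'I_3) := nth 0 [:: G (var3 1) (var3 2); - G (var3 0) (var3 2);
  G (var3 0) (var3 1)] j.
have vG : (\row_j c j) *m G = 0.
  apply/rowP; apply: ord3_ind; rewrite !mxE sum_ord3 !mxE /c /= !inordK //= Gd.
  - by rewrite (Ga (var3 1) (var3 0)) (Ga (var3 2) (var3 0)); ring.
  - by rewrite (Ga (var3 2) (var3 1)); ring.
  by ring.
have v0 : \row_j c j = 0 by rewrite -[LHS](mulmxK unitG) vG mul0mx.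
have cz j : c j = 0 by have /rowP/(_ j) := v0; rewrite !mxE.
have G0 : G = 0.
  apply/matrixP; apply: ord3_ind; apply: ord3_ind; rewrite [RHS]mxE ?Gd //.
  - by have := cz (var3 2); rewrite /c /= inordK.
  - by have := cz (var3 1); rewrite /c /= inordK //= => /eqP; rewrite oppr_eq0 => /eqP.
  - by have := cz (var3 2); rewrite /c /= inordK //= Ga => /eqP; rewrite oppr_eq0 => /eqP.
  - by have := cz (var3 0); rewrite /c /= inordK.
  - by have := cz (var3 1); rewrite /c /= inordK //= Ga opprK.
  - by have := cz (var3 0); rewrite /c /= inordK //= Ga => /eqP; rewrite oppr_eq0 => /eqP.
by move: unitG; rewrite G0 unitmxE det0 unitr0.
Qed.

(** If the complement of v1 has no anisotropic vector, which happens only in characteristic 2, it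
    contains u1, u2 isotropic with beta u1 u2 = 1. Then v1 + u1 and v1 - d u2 both take the value d
    and pair to d - d = 0. *)
Lemma anisotropic_pair : exists v1 v2,
  [/\ beta v1 v1 != 0, beta v2 v2 != 0 & beta v1 v2 = 0].
Proof.
have [v1 d0] := anisotropic_vector; set d := beta v1 v1 in d0.
have [[u [uv uu]]|no] := EM (exists u, beta v1 u = 0 /\ beta u u != 0).
  by exists v1, u.
have [u1 u10 u1M] := @ker_row 1 (G *m v1^T) isT.
have v1u1 : beta v1 u1 = 0 by rewrite betaC -mulmxA u1M mxE.
have u1u1 : beta u1 u1 = 0.
  by apply: contrapT => /eqP h; apply: no; exists u1.
have [u u1u] := beta_nondeg u10.
(* Removing the component along v1 makes u2 orthogonal to v1, and the scaling gives beta u1 u2 =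
   1. *)
pose u2 := (beta u1 u)^-1 *: (u - (beta v1 u / d) *: v1).
have u1v1 : beta u1 v1 = 0 by rewrite betaC.
have v1u2 : beta v1 u2 = 0.
  rewrite /u2 betaZr betaDr -scaleNr betaZr -/d mulNr divfK // subrr; exact: mulr0.
have u1u2 : beta u1 u2 = 1.
  by rewrite /u2 betaZr betaDr -scaleNr betaZr u1v1 mulr0 addr0 mulVf.
have u2u2 : beta u2 u2 = 0.
  by apply: contrapT => /eqP h; apply: no; exists u2.
have u2u1 : beta u2 u1 = 1 by rewrite betaC.
have u2v1 : beta u2 v1 = 0 by rewrite betaC.
clearbody u2; exists (v1 + u1), (v1 + (- d) *: u2).
rewrite !(betaDl, betaDr, betaZl, betaZr) v1u1 u1v1 u1u1 v1u2 u2v1 u2u2 u1u2 -/d.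
by rewrite !mulr0 !addr0 !add0r mulr1 subrr d0.
Qed.

(** Complete an anisotropic pair by v3 orthogonal to both. Pairing with v1 and v2 shows
    independence, and an isotropic v3 would be orthogonal to the whole basis, contrary to
    nondegeneracy. *)
Lemma orthogonal_basis : exists (T : 'M[k]_3) (d : 'I_3 -> k),
  [/\ T \in unitmx, forall i, d i != 0
    & forall i j, (T *m G *m T^T) i j = if i == j then d i else 0].
Proof.
have [v1 [v2 [d1 d2 v12]]] := anisotropic_pair.
have [v3 v30 v3M] := @ker_row 2 (row_mx (G *m v1^T) (G *m v2^T)) isT.
have /eq_row_mx[v31M v32M] : row_mx (v3 *m (G *m v1^T)) (v3 *m (G *m v2^T)) = row_mx 0 0.
  by rewrite -mul_mx_row v3M row_mx0.
have v31 : beta v3 v1 = 0 by rewrite -mulmxA v31M mxE.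
have v32 : beta v3 v2 = 0 by rewrite -mulmxA v32M mxE.
pose V (i : 'I_3) : 'rV[k]_3 := nth 0 [:: v1; v2; v3] i.
pose T := \matrix_i V i.
have TE i j : (T *m G *m T^T) i j = beta (V i) (V j).
  rewrite -[LHS]/((T *m G *m T^T) i j).
  have -> : (T *m G *m T^T) i j = (row i (T *m G) *m col j T^T) 0 0.
    by rewrite !mxE; apply: eq_bigr => l _; rewrite !mxE.
  by rewrite row_mul rowK -tr_row rowK.
exists T, (fun i => beta (V i) (V i)).
have V0 : V (var3 0) = v1 by rewrite /V /= inordK.
have V1 : V (var3 1) = v2 by rewrite /V /= inordK.
have V2 : V (var3 2) = v3 by rewrite /V /= inordK.
have diagT i j : (T *m G *m T^T) i j = if i == j then beta (V i) (V i) else 0.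
  rewrite TE; case: eqP => [->//|]; move: i j.
  apply: ord3_ind; apply: ord3_ind => //; rewrite ?V0 ?V1 ?V2 // => _;
    by rewrite // betaC.
have unitT : T \in unitmx.
  rewrite -row_free_unit -kermx_eq0; apply/rowV0P => x /sub_kermxP.
  rewrite mulmx_sum_row sum_ord3 !rowK V0 V1 V2 => xT.
  have x0 : x 0 (var3 0) = 0.
    have : beta (0 : 'rV[k]_3) v1 = 0 by rewrite !mul0mx mxE.
    rewrite -xT !betaDl !betaZl v31 [beta v2 _]betaC v12 !mulr0 !addr0 => /eqP.
    by rewrite mulf_eq0 (negPf d1) orbF => /eqP.
  have x1 : x 0 (var3 1) = 0.
    have : beta (0 : 'rV[k]_3) v2 = 0 by rewrite !mul0mx mxE.
    rewrite -xT !betaDl !betaZl v32 v12 !mulr0 addr0 add0r => /eqP.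
    by rewrite mulf_eq0 (negPf d2) orbF => /eqP.
  move: xT => /eqP; rewrite x0 x1 !scale0r !add0r scaler_eq0 (negPf v30) orbF => /eqP x2.
  by apply/rowP; apply: ord3_ind; rewrite !mxE.
split=> //; apply: ord3_ind; rewrite ?V0 ?V1 ?V2 //.
apply/eqP => v33; have [u] := beta_nondeg v30.
have := mulmxKV unitT u; move: (u *m invmx T) => x.
rewrite mulmx_sum_row sum_ord3 !rowK V0 V1 V2 => <-.
by rewrite !betaDr !betaZr v31 v32 v33 !mulr0 !addr0 eqxx.
Qed.

End OrthogonalBasis.

(** * Linear substitutions, and the functional vanishing on the five quadrics *)

Section Substitution.
Import TernaryNotations.
Context {k : fieldType}.

Lemma mpoly_ring_ind n (Q : {mpoly k[n]} -> Prop) :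
  (forall e, Q e%:MP) -> (forall i, Q 'X_i) ->
  (forall f g, Q f -> Q g -> Q (f + g)) -> (forall f g, Q f -> Q g -> Q (f * g)) ->
  forall f, Q f.
Proof.
move=> QC QX QD QM f; rewrite [f]mpolyE.
apply: (big_ind Q); [by rewrite -mpolyC0|exact: QD|move=> m _].
rewrite -mul_mpolyC mpolyXE_id; apply: (QM _ _) => //.
apply: (big_ind Q); [by rewrite -mpolyC1|exact: QM|move=> i _].
elim: (m i) => [|j IHj]; first by rewrite expr0 -mpolyC1.
by rewrite exprS; apply: (QM _ _).
Qed.

Lemma comp_mpolyX_homog n n' (L : n.-tuple {mpoly k[n']}) (m : 'X_{1..n}) :
  (forall i, tnth L i \is 1.-homog) -> 'X_[m] \mPo L \is (mdeg m).-homog.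
Proof.
move=> hL; rewrite comp_mpolyX mdegE.
apply: (big_rec2 (fun (f : {mpoly k[n']}) d => f \is d.-homog)) => [|i d f _ hf].
  exact: dhomog1.
have := dhomogMn (m i) (hL i); rewrite mul1n => hi.
exact: dhomogM hi hf.
Qed.

Lemma comp_mpoly_homog n n' (L : n.-tuple {mpoly k[n']}) d (f : {mpoly k[n]}) :
  (forall i, tnth L i \is 1.-homog) -> f \is d.-homog -> f \mPo L \is d.-homog.
Proof.
move=> hL hf; rewrite comp_mpolyEX big_seq; apply: rpred_sum => m mf.
by rewrite rpredZ // -(dhomog_mf hf mf) comp_mpolyX_homog.
Qed.

Lemma comp_mpoly_order n n' (L : n.-tuple {mpoly k[n']}) d (f : {mpoly k[n]}) :
  (forall i, tnth L i \is 1.-homog) -> order_ge d f -> order_ge d (f \mPo L).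
Proof.
move=> hL hf; rewrite comp_mpolyEX big_seq; apply/order_idealP/ideal_sum => m.
rewrite mcoeff_msupp => fm; apply/idealZ/order_idealP => m' hm'.
apply: (dhomog_order (comp_mpolyX_homog m hL)); apply: leq_trans hm' _.
by rewrite leqNgt; apply: contra fm => /hf->.
Qed.

End Substitution.

Section QuadricFunctional.
Import TernaryNotations.
Context {k : fieldType}.
Local Notation K := {mpoly k[3]}.

Lemma homog2E (f : K) : f \is 2.-homog ->
  f = f.@[2, 0, 0] *: (x * x) + f.@[0, 2, 0] *: (y * y) + f.@[0, 0, 2] *: (z * z)
    + f.@[1, 1, 0] *: (x * y) + f.@[1, 0, 1] *: (x * z) + f.@[0, 1, 1] *: (y * z).
Proof.
move=> hf; set g := RHS; suff h : f - g = 0 by rewrite -[LHS](subrK g) h add0r.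
have hX (i j : 'I_3) : ('X_i * 'X_j : K) \is 2.-homog.
  by apply: (dhomogM (d := 1) (e := 1)); rewrite dhomogX; apply/eqP/mdeg1.
have hfg : f - g \is 2.-homog by rewrite rpredB // /g !rpredD // rpredZ.
apply/mpolyP => m; rewrite mcoeff0.
have [m2|m2] := eqVneq (mdeg m) 2%N; last exact: dhomog_nemf_coeff hfg m2.
rewrite [m]mnm3E; move: m2; rewrite [m in mdeg m]mnm3E mdeg_mnm3.
have gE : g = f.@[2, 0, 0] *: (x * (x * 1)) + f.@[0, 2, 0] *: (y * (y * 1))
  + f.@[0, 0, 2] *: (z * (z * 1)) + f.@[1, 1, 0] *: (x * (y * 1))
  + f.@[1, 0, 1] *: (x * (z * 1)) + f.@[0, 1, 1] *: (y * (z * 1)).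
  by rewrite 3!mulr1.
by case: (m (var3 0)) => [|[|[|i]]]; case: (m (var3 1)) => [|[|[|j]]];
  case: (m (var3 2)) => [|[|[|l]]] // _;
  rewrite mcoeffB gE !mcoeff3E !mcoeff3_1 /=; gen_mcoeff; ring.
Qed.

(** The functional X_i X_j |-> G_ij on quadratic parts. Mixed terms are counted once, so [G] is also
    the Gram matrix of (l, l') |-> quadval(l l') on linear forms, even in characteristic 2. *)
Definition quadval (G : 'M[k]_3) (f : K) : k :=
  f.@[2, 0, 0] * G (var3 0) (var3 0) + f.@[0, 2, 0] * G (var3 1) (var3 1)
  + f.@[0, 0, 2] * G (var3 2) (var3 2) + f.@[1, 1, 0] * G (var3 0) (var3 1)
  + f.@[1, 0, 1] * G (var3 0) (var3 2) + f.@[0, 1, 1] * G (var3 1) (var3 2).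

Lemma quadvalP G e f g : quadval G (e *: f + g) = e * quadval G f + quadval G g.
Proof. by rewrite /quadval !mcoeffD !mcoeffZ; gen_mcoeff; ring. Qed.

Definition linform (v : 'I_3 -> k) : K := \sum_i v i *: 'X_i.

Lemma linform_homog v : linform v \is 1.-homog.
Proof. by apply: rpred_sum => i _; rewrite rpredZ // dhomogX; apply/eqP/mdeg1. Qed.

Lemma quadval_mul (G : 'M[k]_3) u v : G^T = G ->
  quadval G (linform u * linform v) = \sum_i \sum_j u i * G i j * v j.
Proof.
move=> symG; have Gs i j : G i j = G j i by rewrite -{1}symG mxE.
have -> : linform u * linform v = linform u * (linform v * 1) by rewrite mulr1.
rewrite /linform !sum_ord3 -!mul_mpolyC !mulrDl -!mulrA.
rewrite (Gs (var3 1) (var3 0)) (Gs (var3 2) (var3 0)) (Gs (var3 2) (var3 1)).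
rewrite /quadval !mcoeff3E !mcoeff3_1 /=.
by move: (u _) (u _) (u _) (v _) (v _) (v _)
  (G _ _) (G _ _) (G _ _) (G _ _) (G _ _) (G _ _) => *; ring.
Qed.

(** Quadrics form a space of dimension 6. Completing q to a basis by one vector v0, the coordinate
    along v0 is a functional whose kernel is exactly the span of q. *)
Lemma quadric_functional (q : 5.-tuple (dhomog 3 k 2)) : free q ->
  exists G : 'M[k]_3, [/\ G^T = G, forall i, quadval G (tnth q i) = 0
    & forall f : K, f \is 2.-homog -> quadval G f = 0 ->
      exists e : 'I_5 -> k, f = \sum_i e i *: (tnth q i : K)].
Proof.
move=> freeq; pose V := dhomog 3 k 2.
have dimV : \dim {:V} = 6%N by rewrite dimvf.
have dimq : \dim <<q>> = 5%N by move: freeq; rewrite /free size_tuple => /eqP.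
have [v0 v0q] : exists v0 : V, v0 \notin <<q>>%VS.
  apply: contrapT => no; suff /dimvS : ({:V} <= <<q>>)%VS by rewrite dimV dimq.
  by apply/subvP => v _; apply: contrapT => /negP vq; apply: no; exists v.
pose X := [tuple of v0 :: q].
have freeX : free X by rewrite free_cons v0q.
have spanX : <<X>>%VS = fullv.
  apply/eqP; rewrite -(dimv_leqif_eq (subvf _)) dimV.
  by move: freeX; rewrite /free size_tuple.
pose tau (v : V) := coord X ord0 v.
have tauP e u v : tau (e *: u + v) = e * tau u + tau v by rewrite /tau linearP.
have hX (i j : 'I_3) : ('X_i * 'X_j : K) \is 2.-homog.
  by apply: (dhomogM (d := 1) (e := 1)); rewrite dhomogX; apply/eqP/mdeg1.
pose mon i j : V := DHomog (hX i j).
pose G := \matrix_(i, j) tau (mon i j).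
have tauD u v : tau (u + v) = tau u + tau v by rewrite /tau raddfD.
have tauZ e v : tau (e *: v) = e * tau v by rewrite /tau linearZ.
have tauG v : tau v = quadval G (v : K).
  have hv : val v \is 2.-homog by apply: valP.
  have {1}-> : v = (val v).@[2, 0, 0] *: mon (var3 0) (var3 0)
    + (val v).@[0, 2, 0] *: mon (var3 1) (var3 1)
    + (val v).@[0, 0, 2] *: mon (var3 2) (var3 2)
    + (val v).@[1, 1, 0] *: mon (var3 0) (var3 1)
    + (val v).@[1, 0, 1] *: mon (var3 0) (var3 2)
    + (val v).@[0, 1, 1] *: mon (var3 1) (var3 2).
    by apply: val_inj; rewrite {1}(homog2E hv).
  by rewrite !tauD !tauZ /quadval !mxE.
exists G; split.
- apply/matrixP => i j; rewrite !mxE; congr tau; apply: val_inj; exact: mulrC.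
- move=> i; rewrite -tauG.
  have -> : tnth q i = X`_(lift ord0 i) by rewrite /= (tnth_nth 0).
  by rewrite /tau coord_free.
move=> f hf fG; pose v : V := DHomog hf.
have tv : tau v = 0 by rewrite tauG.
have vX : v \in <<X>>%VS by rewrite spanX memvf.
exists (fun i => coord X (lift ord0 i) v).
have := congr1 val (coord_span vX); rewrite big_ord_recl -/(tau v) tv scale0r add0r.
rewrite [LHS]/= => ->; rewrite raddf_sum; apply: eq_bigr => i _ /=.
by rewrite (tnth_nth 0).
Qed.

End QuadricFunctional.

(** * Change of coordinates to the normal form *)

Section Coordinates.
Import TernaryNotations.
Context {k : fieldType} (s : nat).
Local Notation K := {mpoly k[3]}.
Local Notation P := {mpoly k[3 + s]}.

Lemma linform_comb (m : nat) (M : 'M[k]_(m, 3)) (v : 'I_m -> k) :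
  \sum_u v u *: linform (M u) = linform (fun j => \sum_u v u * M u j).
Proof.
rewrite /linform; under eq_bigr => u _ do rewrite scaler_sumr.
rewrite exchange_big; apply: eq_bigr => j _ /=.
by rewrite scaler_suml; apply: eq_bigr => u _; rewrite scalerA.
Qed.

Lemma linform_inv (M N : 'M[k]_3) j : M *m N = 1%:M ->
  \sum_u M j u *: linform (N u) = 'X_j.
Proof.
move=> MN; rewrite linform_comb /linform.
under eq_bigr => i _.
  have -> : \sum_u M j u * N u i = (j == i)%:R.
    by have /matrixP/(_ j i) := MN; rewrite !mxE.
  over.
rewrite (bigD1 j) //= eqxx scale1r big1 ?addr0 // => i ij.
by rewrite eq_sym (negPf ij) scale0r.
Qed.

Lemma sub_rmorphism_mem n (phi : {rmorphism {mpoly k[n]} -> {mpoly k[n]}})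
    (J : ideal {mpoly k[n]}) :
  (forall e, phi e%:MP = e%:MP) -> (forall i, 'X_i - phi 'X_i \in J) ->
  forall f, f - phi f \in J.
Proof.
move=> phiC phiX; apply: mpoly_ring_ind => [e||f g hf hg|f g hf hg].
- by rewrite phiC subrr ideal0.
- exact: phiX.
- by rewrite rmorphD opprD addrACA; apply: idealD.
have -> : f * g - phi (f * g) = f * (g - phi g) + (f - phi f) * phi g.
  by rewrite rmorphM mulrBr mulrBl addrA subrK.
by apply: idealD; [apply: idealM|apply: idealMr].
Qed.

Variable T : 'M[k]_3.
Hypothesis unitT : T \in unitmx.
Local Notation S := (invmx T).

(** The rows of [T] are the orthogonal basis. [kappa] sends x, y, z to these linear forms, [sigma]
    undoes this on the X's and sends the Y's to 0, and [iota] is [kappa] followed by the inclusion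
    into P. *)
Definition kappa_tuple : 3.-tuple K := [tuple linform (T i) | i < 3].
Definition sigma_tuple : (3 + s).-tuple K :=
  [tuple match split i with inl j => linform (S j) | inr _ => 0 end | i < 3 + s].
Definition iota_tuple : 3.-tuple P := [tuple inX s (linform (T i)) | i < 3].

Local Notation kappa := (comp_mpoly kappa_tuple).
Local Notation sigma := (comp_mpoly sigma_tuple).
Local Notation iota := (comp_mpoly iota_tuple).

Lemma comp_linform n (L : 3.-tuple {mpoly k[n]}) v :
  linform v \mPo L = \sum_i v i *: tnth L i.
Proof.
rewrite /linform raddf_sum; apply: eq_bigr => i _ /=.
by rewrite comp_mpolyZ comp_mpolyXU (tnth_nth 0).
Qed.

Lemma inX_X j : inX s 'X_j = 'X_(lshift s j) :> P.
Proof. by rewrite /inX comp_mpolyXU nth_mktuple. Qed.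

Lemma sigma_lshift j : sigma 'X_(lshift s j) = linform (S j).
Proof. by rewrite comp_mpolyXU nth_mktuple (unsplitK (inl j)). Qed.

Lemma sigma_rshift j : sigma 'X_(rshift 3 j) = 0.
Proof. by rewrite comp_mpolyXU nth_mktuple (unsplitK (inr j)). Qed.

Lemma sigma_inX_X j : sigma (inX s 'X_j) = linform (S j).
Proof. by rewrite inX_X sigma_lshift. Qed.

Lemma iotaE (f : K) : iota f = inX s (kappa f).
Proof.
move: f; apply: mpoly_ring_ind => [e|i|f g hf hg|f g hf hg].
- by rewrite /inX !comp_mpolyC.
- by rewrite !comp_mpolyXU !nth_mktuple.
- by rewrite /inX !comp_mpolyD hf hg.
by rewrite /inX !rmorphM /= hf hg.
Qed.

Lemma kappa_sigma_inX (f : K) : kappa (sigma (inX s f)) = f.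
Proof.
move: f; apply: mpoly_ring_ind => [e|i|f g hf hg|f g hf hg].
- by rewrite /inX !comp_mpolyC.
- rewrite sigma_inX_X comp_linform -[RHS](linform_inv i (mulVmx unitT)).
  by apply: eq_bigr => u _; rewrite tnth_mktuple.
- by rewrite /inX !comp_mpolyD hf hg.
by rewrite /inX !rmorphM /= hf hg.
Qed.

Lemma sigma_iota (f : K) : sigma (iota f) = f.
Proof.
move: f; apply: mpoly_ring_ind => [e|i|f g hf hg|f g hf hg].
- by rewrite !comp_mpolyC.
- rewrite comp_mpolyXU nth_mktuple /inX comp_linform raddf_sum.
  rewrite -[RHS](linform_inv i (mulmxV unitT)); apply: eq_bigr => u _ /=.
  by rewrite comp_mpolyZ tnth_mktuple sigma_lshift.
- by rewrite !comp_mpolyD hf hg.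
by rewrite !rmorphM /= hf hg.
Qed.

Lemma sub_iota_sigma (f : P) : f - iota (sigma f) \in (idealB'' s : ideal P).
Proof.
pose phi : {rmorphism P -> P} := iota \o sigma.
apply: (sub_rmorphism_mem (phi := phi)) => [e|i].
  by rewrite /= !comp_mpolyC.
rewrite -[phi _]/(iota (sigma _)).
case: (split_ordP i) => j ->; last first.
  by rewrite sigma_rshift comp_mpoly0 subr0; apply: mem_span; exists j.
by rewrite iotaE -inX_X kappa_sigma_inX subrr ideal0.
Qed.

Lemma sigma_ker (f : P) : sigma f = 0 ->
  exists u : 'I_s -> P, f = \sum_j u j * 'X_(rshift 3 j).
Proof.
move=> f0; have := sub_iota_sigma f; rewrite f0 comp_mpoly0 subr0.
by move/span_finP.
Qed.

Lemma sigma_order d (f : P) : order_ge d f -> order_ge d (sigma f).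
Proof.
apply: comp_mpoly_order => i; rewrite tnth_mktuple.
by case: (split i) => [j|_]; [apply: linform_homog|apply: rpred0].
Qed.

Lemma sigma_inX_homog d (f : K) : f \is d.-homog -> sigma (inX s f) \is d.-homog.
Proof.
move=> hf; apply: comp_mpoly_homog => [i|].
  rewrite tnth_mktuple.
  by case: (split i) => [j|_]; [apply: linform_homog|apply: rpred0].
by apply: comp_mpoly_homog => // i; rewrite tnth_mktuple dhomogX; apply/eqP/mdeg1.
Qed.

Lemma kappa_homog d (f : K) : f \is d.-homog -> kappa f \is d.-homog.
Proof. by apply: comp_mpoly_homog => i; rewrite tnth_mktuple; apply: linform_homog. Qed.

Variables (G : 'M[k]_3) (d : 'I_3 -> k) (q : 5.-tuple (dhomog 3 k 2)).
Hypothesis symG : G^T = G.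
Hypothesis d0 : forall i, d i != 0.
Hypothesis orthT : forall i j, (T *m G *m T^T) i j = if i == j then d i else 0.
Hypothesis Gq : forall i, quadval G (tnth q i) = 0.
Hypothesis Gspan : forall f : K, f \is 2.-homog -> quadval G f = 0 ->
  exists e : 'I_5 -> k, f = \sum_i e i *: (tnth q i : K).

Local Notation a := ((d (var3 0))^-1).
Local Notation b := ((d (var3 1))^-1).
Local Notation c := ((d (var3 2))^-1).

(** Orthogonality kills the mixed terms, and x^2, y^2, z^2 take the values d_i. As theta takes the
    values 1/a, 1/b, 1/c there, a, b, c are the inverses of the d_i. *)
Lemma quadval_kappa (f : K) : f \is 2.-homog -> quadval G (kappa f) = theta a b c f.
Proof.
move=> hf; rewrite {1}(homog2E hf).
have qT i j : quadval G (kappa ('X_i * 'X_j)) = if i == j then d i else 0.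
  rewrite rmorphM /= !comp_mpolyXU !nth_mktuple quadval_mul // -orthT.
  rewrite mxE exchange_big; apply: eq_bigr => v _ /=.
  by rewrite mxE mulr_suml; apply: eq_bigr => u _; rewrite !mxE.
have qD g h : quadval G (g + h) = quadval G g + quadval G h.
  by rewrite -[g]scale1r quadvalP mul1r scale1r.
have q0 : quadval G 0 = 0 by rewrite /quadval !mcoeff0 !mul0r !addr0.
have qZ e g : quadval G (e *: g) = e * quadval G g.
  by rewrite -[_ *: _]addr0 quadvalP q0 addr0.
have v01 : (var3 0 == var3 1) = false by rewrite -val_eqE /= !inordK.
have v02 : (var3 0 == var3 2) = false by rewrite -val_eqE /= !inordK.
have v12 : (var3 1 == var3 2) = false by rewrite -val_eqE /= !inordK.
have := (qT (var3 0) (var3 1), qT (var3 0) (var3 2), qT (var3 1) (var3 2)).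
have := (qT (var3 0) (var3 0), qT (var3 1) (var3 1), qT (var3 2) (var3 2)).
rewrite !eqxx v01 v02 v12 !comp_mpolyD !comp_mpolyZ /theta !invrK.
move: (kappa (x * x)) (kappa (y * y)) (kappa (z * z)) => xx yy zz.
move: (kappa (x * y)) (kappa (x * z)) (kappa (y * z)) => xy xz yz [[xxE yyE] zzE].
move=> [[xyE xzE] yzE]; gen_mcoeff.
by rewrite !qD !qZ xxE yyE zzE xyE xzE yzE !mulr0 !addr0.
Qed.

Lemma quad5_homog i : quad5 a b c i \is 2.-homog.
Proof.
have hX (u v : 'I_3) : ('X_u * 'X_v : K) \is 2.-homog.
  by apply: (dhomogM (d := 1) (e := 1)); rewrite dhomogX; apply/eqP/mdeg1.
by case: i => [[|[|[|[|[|//]]]]] lt_i]; rewrite /quad5 [nth _ _ _]/= // !mul_mpolyC;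
  rewrite rpredB // rpredZ.
Qed.

(** Both systems of quadrics consist of zeros of the same functional: [Gspan] writes the normal
    forms through q, and [apolar_quad5] writes sigma of q through the normal forms. *)
Lemma idealB'P (f : P) :
  f \in idealB' s q <-> exists r : 'I_5 -> P, f = \sum_i r i * iota (quad5 a b c i).
Proof.
have a0 : a != 0 by rewrite invr_eq0.
have b0 : b != 0 by rewrite invr_eq0.
have c0 : c != 0 by rewrite invr_eq0.
have th0 i : theta a b c (quad5 a b c i) = 0.
  by rewrite -[quad5 _ _ _ _]mul1r theta_quad5.
split=> [|[r ->]]; last first.
  apply: ideal_sum => i _; apply: (@idealM P); rewrite iotaE.
  have [|e ->] := Gspan (kappa_homog (quad5_homog i)).
    by rewrite quadval_kappa ?quad5_homog.
  have -> : inX s (\sum_j e j *: (tnth q j : K)) = \sum_j e j *: inX s (tnth q j) :> P.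
    by rewrite /inX raddf_sum; apply: eq_bigr => j _; rewrite /= comp_mpolyZ.
  by apply: ideal_sum => j _; apply/idealZ/mem_span; exists j.
suff h : {subset idealB' s q <=
    Defs.span (fun v : P^o => exists i, v = iota (quad5 a b c i))}.
  by move/h/span_finP.
apply: span_sub => _ [i ->].
have hq : (tnth q i : K) \is 2.-homog by apply: valP.
have hf := sigma_inX_homog hq.
have /span_finP[r rE'] : sigma (inX s (tnth q i)) \in quad5_ideal a b c.
  apply: (apolar_quad5 a0 b0 c0); try by apply: (dhomog_order hf); rewrite mdeg_mnm3.
  by rewrite -(quadval_kappa hf) kappa_sigma_inX.
have {rE'} rE : sigma (inX s (tnth q i)) = \sum_j r j * quad5 a b c j := rE'.
rewrite -[tnth q i : K]kappa_sigma_inX -iotaE rE.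
have -> : iota (\sum_j r j * quad5 a b c j) = \sum_j iota (r j) * iota (quad5 a b c j).
  by rewrite rmorph_sum; apply: eq_bigr => j _; apply: rmorphM.
by apply: ideal_sum => j _; apply/idealM/mem_span; exists j.
Qed.

End Coordinates.

(** * The socle condition as nondegeneracy of the functional *)

Section SocleCondition.
Context {k : fieldType} (s : nat) (q : 5.-tuple (dhomog 3 k 2)).
Local Notation K := {mpoly k[3]}.
Local Notation P := {mpoly k[3 + s]}.

Lemma idealBP (f : P) : f \in idealB s q <->
  exists (f' : P) (u : 'I_s -> P),
    f' \in idealB' s q /\ f = f' + \sum_j u j * 'X_(rshift 3 j).
Proof.
split=> [/asboolP[f1 [f2 [Bf1 /span_finP[u ->] ->]]]|[f' [u [Bf' ->]]]].
  by exists f1, u.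
apply/asboolP; exists f', (\sum_j u j * 'X_(rshift 3 j)); split=> //.
by apply/span_finP; exists u.
Qed.

Variable G : 'M[k]_3.
Hypothesis symG : G^T = G.
Hypothesis Gspan : forall f : K, f \is 2.-homog -> quadval G f = 0 ->
  exists e : 'I_5 -> k, f = \sum_i e i *: (tnth q i : K).

(** A kernel vector v of [G] gives a linear form l for which every X_j l is a zero of the
    functional, hence lies in the span of q. So l represents a socle element of degree 1 and lies in
    B; modulo the Y's, elements of B have order 2, which forces v = 0. *)
Lemma socle_unitmx :
  (forall f : quo (idealB s q : ideal P), f \in socle (quo (idealB s q : ideal P)) ->
     quo_homog 1 f -> f = 0) ->
  G \in unitmx.
Proof.
move=> soc; rewrite -row_free_unit -kermx_eq0; apply/rowV0P => v /sub_kermxP vG.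
pose l : K := linform (v 0); pose L : P := inX s l.
have L1 : L \is 1.-homog.
  apply: comp_mpoly_homog (linform_homog _) => i.
  by rewrite tnth_mktuple dhomogX; apply/eqP/mdeg1.
have XL i : 'X_i * L \in (idealB s q : ideal P).
  apply/idealBP; case: (split_ordP i) => j ->.
    exists (inX s ('X_j * l)), (fun=> 0); split; last first.
      rewrite big1 ?addr0 => [|u _]; last exact: mul0r.
      by rewrite -inX_X /inX rmorphM.
    have XjE : 'X_j = linform (fun u => (u == j)%:R) :> K.
      rewrite /linform (bigD1 j) //= eqxx scale1r big1 ?addr0 // => u /negPf->.
      exact: scale0r.
    have [||e ->] := @Gspan ('X_j * l).
    - by apply: (dhomogM (d := 1) (e := 1)); rewrite ?linform_homog // dhomogX; apply/eqP/mdeg1.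
    - rewrite XjE quadval_mul // (bigD1 j) //= eqxx.
      rewrite [X in _ + X]big1 => [|u /negPf->]; last first.
        by rewrite big1 // => w _; rewrite mul0r mul0r.
      have /rowP/(_ j) := vG; rewrite !mxE => vGj; rewrite addr0 -[RHS]vGj.
      apply: eq_bigr => u _; rewrite mul1r mulrC; congr (_ * _).
      by rewrite -{1}symG mxE.
    have -> : inX s (\sum_i e i *: (tnth q i : K)) = \sum_i e i *: inX s (tnth q i) :> P.
      by rewrite /inX raddf_sum; apply: eq_bigr => u _; rewrite /= comp_mpolyZ.
    by apply: ideal_sum => u _; apply/idealZ/mem_span; exists u.
  exists 0, (fun u => if u == j then L else 0); split; first exact: ideal0.
  rewrite add0r (bigD1 j) //= eqxx big1 => [|u /negPf->]; last exact: mul0r.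
  by rewrite addr0; apply: mulrC.
have gL (g : P) : g \is 1.-homog -> g * L \in (idealB s q : ideal P).
  move=> hg; rewrite [g]mpolyE mulr_suml big_seq; apply: ideal_sum => m gm.
  have /mdeg1P[i /eqP->] : mdeg m == 1%N by apply/eqP/(dhomog_mf hg).
  by rewrite -scalerAl; apply: idealZ.
have LB : L \in (idealB s q : ideal P).
  suff /eqP : \pi_(quo (idealB s q : ideal P)) (L : P^o) = 0 by rewrite (@quo_eq0 P).
  apply: soc; last by exists L.
  apply/asboolP => f /asboolP[m [e [g [g1 ->]]]].
  rewrite (@quoZ P); apply/eqP; rewrite (@quo_eq0 P).
  have -> : (\sum_i e i *: g i) *: (L : P^o) = (\sum_i e i * g i) * L by [].
  rewrite mulr_suml.
  by apply: ideal_sum => i _; rewrite -mulrA; apply/idealM/gL.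
(* With the identity in place of [T], [sigma] merely sets the Y's to 0. *)
have unit1 : (1%:M : 'M[k]_3) \in unitmx by apply: unitmx1.
have [f' [u [/span_finP[r ->] LE']]] := (iffLR (idealBP L)) LB.
have {LE'} LE : L = \sum_i r i * inX s (tnth q i) + \sum_j u j * 'X_(rshift 3 j) := LE'.
have l2 : order_ge 2 l.
  rewrite -(kappa_sigma_inX s unit1 l) -/L LE.
  apply: comp_mpoly_order => [i|]; first by rewrite tnth_mktuple linform_homog.
  rewrite comp_mpolyD [X in _ + X]raddf_sum [X in _ + X]big1 => [|j _]; last first.
    by rewrite /= rmorphM /= sigma_rshift mulr0.
  rewrite addr0 rmorph_sum; apply/order_idealP/ideal_sum => i _.
  rewrite rmorphM; apply/idealM/order_idealP/dhomog_order.
  by apply: sigma_inX_homog; apply: valP.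
apply/rowP => j; rewrite mxE; have := l2 U_(j)%MM; rewrite mdeg1 => /(_ isT).
rewrite /l /linform raddf_sum (bigD1 j) //= mcoeffZ mcoeffX eqxx mulr1 big1 ?addr0 //.
move=> i /negPf ij; rewrite mcoeffZ mcoeffX.
case: eqP => [/mnmP/(_ i)|_]; last by rewrite mulr0.
by rewrite !mnm1E eqxx eq_sym ij.
Qed.

End SocleCondition.

(** * The second syzygy of the canonical module *)

Theorem theorem1p3 (k : fieldType) (s : nat) (q : 5.-tuple (dhomog 3 k 2))
    (A : ideal {mpoly k[3 + s]}) :
  let B' := idealB' s q in
  let B := idealB s q in
  free q ->
  homog_ideal A ->
  {subset A <= exp_ideal max_homog_ideal 5} ->
  artinian_gorenstein_local (qring A) ->
  (forall x : quo B, x \in socle (quo B) -> quo_homog 1 x -> x = 0) ->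
  exists ann_B'BB' : annihilates (colon A B) (subquo B' (mul_ideal B B')),
    second_syzygy_has_summand (canonical_module A B) (over_qring ann_B'BB').
Proof.
move=> B' B freeq homA sA [artA _ injA] soc.
have [G [symG Gq Gspan]] := quadric_functional freeq.
have unitG := socle_unitmx symG Gspan soc.
have [T [d [unitT d0 orthT]]] := orthogonal_basis symG unitG.
have A5 f : f \in A -> order_ge 5 f by move=> /sA/exp_ideal_order/order_idealP.
have A1 : (1 : {mpoly k[3 + s]}) \notin A.
  apply/negP => /A5/(_ 0%MM); rewrite mdeg0 mcoeff1 eqxx => /(_ isT)/eqP.
  by rewrite oner_eq0.
have [Lam [LamA Lam_nondeg]] := gorenstein_functional homA A1 artA injA.
have [N A_bound] := artinian_bound homA artA.
have a0 : (d (var3 0))^-1 != 0 by rewrite invr_eq0.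
have b0 : (d (var3 1))^-1 != 0 by rewrite invr_eq0.
have c0 : (d (var3 2))^-1 != 0 by rewrite invr_eq0.
pose sigma : {rmorphism {mpoly k[3 + s]} -> {mpoly k[3]}} := comp_mpoly (sigma_tuple s T).
pose iota : {rmorphism {mpoly k[3]} -> {mpoly k[3 + s]}} := comp_mpoly (iota_tuple s T).
pose Y (j : 'I_s) : {mpoly k[3 + s]} := 'X_(rshift 3 j).
have sigmaZ e f : sigma (e *: f) = e *: sigma f by apply: comp_mpolyZ.
have iotaZ e f : iota (e *: f) = e *: iota f by apply: comp_mpolyZ.
have iotaK f : sigma (iota f) = f by apply: sigma_iota.
have sigmaO dg f : order_ge dg f -> order_ge dg (sigma f) by apply: sigma_order.
have sigmaY j : sigma (Y j) = 0 by apply: sigma_rshift.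
have sigmaK f : sigma f = 0 -> exists u, f = \sum_j u j * Y j by apply: sigma_ker.
apply: (linked_second_syzygy a0 b0 c0 sigmaZ iotaZ iotaK sigmaO sigmaY sigmaK _ _
  A5 A_bound LamA Lam_nondeg).
- exact: (idealB'P unitT symG d0 orthT Gq Gspan).
- exact: idealBP.
Qed.
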